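(* Fix $\alpha\in(0,1)$ and, for each $n\ge 2$, consider the 2-choices dynamics with node failures with failure probability $\alpha$ on the complete graph with $n$ nodes. Let $A(t)$ denote the number of nodes with opinion $1$ at time $t$, let $T_{1/2}=\inf\{t\ge 0: A(t)\in\{\lceil n/2\rceil,\lfloor n/2\rfloor\}\}$, and let $t_{\mathrm{mix}}$ be the mixing time. Then the following hold. 1. If $0<\alpha<1/3$, then there is a constant $\kappa>0$ such that $t_{\mathrm{mix}}\ge \exp(\kappa n)$ for all sufficiently large $n$. Moreover, for every fixed $p\in[0,1]$ with $p\ne 1/2$ there is a constant $\kappa>0$ such that $\mathbb{P}\left(T_{1/2}\ge \exp(\kappa n)\mid A(0)=\lceil np\rceil\right)\to 1$ as $n\to\infty$. 2. If $\alpha>1/3$, then $t_{\mathrm{mix}}=O(\log n)$, and $\mathbb{E}[T_{1/2}\mid A(0)=a]=O(\log n)$ for any $a\in\{0,1,\ldots,n\}$, that is, there is a constant $C$ such that for all sufficiently large $n$ and all $a\in\{0,1,\dots,n\}$, $\mathbb{E}[T_{1/2}\mid A(0)=a]\le C\log n$.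
   Context: 2-choices dynamics with node failures: let $G=(V,E)$ be a simple, undirected, connected graph with $|V|=n$. Each node $v$ holds an opinion $X_v(t)\in\{0,1\}$ at time $t\geq 0$ and updates at the points of an independent unit-rate Poisson process. At an update, with probability $1-\alpha$ the node samples two neighbours uniformly at random with replacement and, if they have the same opinion, adopts it (otherwise it keeps its own opinion); with probability $\alpha$ it adopts one of the two opinions $0,1$ uniformly at random, independently of everything else. Then $\mathbf X=(\mathbf X(t))_{t\ge0}$, $\mathbf X(t)=(X_v(t))_{v\in V}$, is an ergodic continuous-time Markov chain on $\mathcal X=\{0,1\}^n$ with unique stationary distribution $\boldsymbol\pi$. Its nonzero off-diagonal rates are: a node $v$ with opinion $0$ flips to $1$ at rate $\frac{\alpha}{2}+(1-\alpha)(d_v^A/d_v)^2$ and a node $v$ with opinion $1$ flips to $0$ at rate $\frac{\alpha}{2}+(1-\alpha)(d_v^B/d_v)^2$, where $d_v$ is the degree of $v$ and $d_v^A$, $d_v^B$ are the numbers of neighbours of $v$ with current opinion $1$ and $0$ respectively. On the complete graph, $A(t)$ is itself a birth-death Markov chain on $\{0,\dots,n\}$ with birth rate $q_+(a)=(n-a)\left[\frac\alpha2+(1-\alpha)\left(\frac{a}{n-1}\right)^2\right]$ and death rate $q_-(a)=a\left[\frac\alpha2+(1-\alpha)\left(\frac{n-a}{n-1}\right)^2\right]$. Mixing time: $t_{\mathrm{mix}}=\inf\{t\ge0: d(t)\le 1/4\}$, where $d(t)=\max_{\mathbf x\in\mathcal X}\max_{\Gamma\subseteq\mathcal X}|\mathbb{P}_{\mathbf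 x}(\mathbf X(t)\in\Gamma)-\boldsymbol\pi(\Gamma)|$ and $\mathbb{P}_{\mathbf x}$ denotes probability conditioned on $\mathbf X(0)=\mathbf x$. *)

(* Defs.v *)
From HB Require Import structures.
From mathcomp Require Import all_boot all_order all_algebra.
From mathcomp Require Import all_classical all_reals all_analysis.
Import Order.TTheory GRing.Theory Num.Theory.
Import numFieldNormedType.Exports.

Set Implicit Arguments.
Unset Strict Implicit.
Unset Printing Implicit Defensive.

Local Open Scope classical_set_scope.
Local Open Scope ring_scope.

(** * Continuous-time Markov chains on a finite state space *)

Section ContinuousTimeMarkovChain.
Context {R : realType} {S : finType}.

Definition gen_mx (q : S -> S -> R) : 'M[R]_#|S| :=
  \matrix_(i, j) q (enum_val i) (enum_val j).

(* The (x, y) entry of the matrix exponential exp(tQ). *)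
Definition transition (q : S -> S -> R) (t : R) (x y : S) : R :=
  limn (series (fun k : nat =>
    t ^+ k / k`!%:R * (gen_mx q ^+ k) (enum_rank x) (enum_rank y))).

Definition stationary (q : S -> S -> R) (pi : S -> R) : Prop :=
  [/\ forall x, 0 <= pi x,
      \sum_x pi x = 1 &
      forall (t : R) y, 0 <= t -> \sum_x pi x * transition q t x y = pi y].

Context {d : measure_display} {Omega : measurableType d}.

(* [X t w] is the state at time [t]; only times [t >= 0] matter.  Under [P x]
   the process is the right-continuous chain with generator [q] started at
   [x].  The case [k = 0] of the last clause is the initial condition
   [P x (X 0 = x) = 1]. *)
Record markov_chain (q : S -> S -> R) (X : R -> Omega -> S)
    (P : S -> probability Omega R) : Prop := MarkovChain {
  chain_measurable : forall (t : R) y, 0 <= t ->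
    measurable [set w | X t w = y];
  chain_right_continuous : forall (t : R) w, 0 <= t ->
    \forall s \near t^'+, X s w = X t w;
  chain_finite_dim : forall (k : nat) (t : nat -> R) (y : nat -> S),
    t 0%N = 0 -> {homo t : i j / (i <= j)%N >-> i <= j} ->
    P (y 0%N) [set w | forall i, (i <= k)%N -> X (t i) w = y i] =
    (\prod_(i < k) transition q (t i.+1 - t i) (y i) (y i.+1))%:E
}.

Definition distance_to_stationarity (X : R -> Omega -> S)
    (P : S -> probability Omega R) (pi : S -> R) (t : R) : R :=
  \big[Order.max/0]_(x : S) \big[Order.max/0]_(Gamma : {set S})
    `|fine (P x [set w | X t w \in Gamma]) - \sum_(y in Gamma) pi y|.

(* The infimum is taken in [\bar R], so that it would be [+oo] on the empty
   set, whereas the infimum of the empty set in [R] is [0]. *)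
Definition mixing_time (X : R -> Omega -> S)
    (P : S -> probability Omega R) (pi : S -> R) : \bar R :=
  ereal_inf [set t%:E | t in
    [set t : R | 0 <= t /\ distance_to_stationarity X P pi t <= 4^-1]].

Definition hitting_time (X : R -> Omega -> S) (A : pred S) (w : Omega)
    : \bar R :=
  ereal_inf [set t%:E | t in [set t : R | 0 <= t /\ A (X t w)]].

End ContinuousTimeMarkovChain.

(** * 2-choices dynamics with node failures *)

Definition config (V : finType) := {ffun V -> bool}.

Definition ones (V : finType) (x : config V) : nat := #|[pred v | x v]|.

Section TwoChoices.
Context {R : realType} {V : finType}.
Variables (alpha : R) (e : rel V).

Definition degree (v : V) : nat := #|[pred u | e v u]|.

Definition neighbours_with (x : config V) (v : V) (b : bool) : nat :=
  #|[pred u | e v u & x u == b]|.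

Definition flip (x : config V) (v : V) : config V :=
  [ffun u => if u == v then ~~ x u else x u].

Definition flip_rate (x : config V) (v : V) : R :=
  alpha / 2 + (1 - alpha) *
    ((neighbours_with x v (~~ x v))%:R / (degree v)%:R) ^+ 2.

Definition two_choices (x y : config V) : R :=
  if y == x then - \sum_v flip_rate x v
  else \sum_(v | y == flip x v) flip_rate x v.

End TwoChoices.

Definition complete_graph (n : nat) : rel 'I_n := [rel u v | u != v].

(* [uphalf n] and [n./2] are the ceiling and the floor of n/2. *)
Definition balanced (n : nat) (x : config 'I_n) : bool :=
  (ones x == uphalf n) || (ones x == n./2).

(* Main.v *)
Require Import Defs.
From HB Require Import structures.
From mathcomp Require Import all_boot all_order all_algebra.
From mathcomp Require Import all_classical all_reals all_analysis.
From mathcomp Require Import measurable_realfun.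
From mathcomp Require Import ring lra zify.
Import Order.TTheory GRing.Theory Num.Theory.
Import numFieldNormedType.Exports.

(* All estimates are drift estimates for the generator [Q], transferred to the
   process by sampling it at times [0, h, 2 h, ...] and letting [h] tend to 0
   in [exp(h Q) = 1 + h Q + O(h^2)]. Let [a] be the number of nodes that hold a
   given opinion. The drift of [a] is
   [(2 a - n) ((1 - alpha) a (n - a) / (n - 1)^2 - alpha / 2)], which near
   [a = n / 2] points away from [n / 2] if [alpha < 1/3] and towards it if
   [alpha > 1/3].
   - If [alpha < 1/3], then [rho^(a - L)], for some [rho < 1] and [L] slightly
     above [n / 2], has exponentially small drift above [L], so [a] stays above
     [L] for an exponentially long time. Started from all ones and from all
     zeros, the chain is concentrated on disjoint sets until then.
   - If [alpha > 1/3], then [1 + h Q] contracts Lipschitz constants on the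
     hypercube by a factor [1 - c h], hence the mixing time is at most
     [2 / c ln n]. With [s = sqrt n], the function
     [f(k) = K \sum_(1 <= j <= k) 1 / (j + s)] of the distance [k] to [n / 2]
     has drift at most [-1]: this comes from the drift of [a] for [k >= s] and
     from the concavity of [f] for [k <= s]. It is [O(log n)]. *)

Set Implicit Arguments.
Unset Strict Implicit.
Unset Printing Implicit Defensive.

Local Open Scope classical_set_scope.
Local Open Scope ring_scope.

(** * Short-time expansion of the matrix exponential *)

Section MatrixExponential.
Context {R : realType}.

Lemma mx_exp_entry_le n (A : 'M[R]_n) (k : nat) i j :
  `|(A ^+ k) i j| <= (\sum_i \sum_j `|A i j|) ^+ k.
Proof.
elim: k i j => [|k IH] i j.
  by rewrite !expr0 mxE; case: (i == j); rewrite ?normr1 ?normr0.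
rewrite exprS mxE exprS (le_trans (ler_norm_sum _ _ _))//.
apply: (@le_trans _ _ (\sum_l `|A i l| * (\sum_i \sum_j `|A i j|) ^+ k)).
  by apply: ler_sum => l _; rewrite normrM ler_wpM2l.
rewrite -mulr_suml ler_wpM2r ?exprn_ge0//.
  by apply: sumr_ge0 => i0 _; apply: sumr_ge0.
rewrite [leRHS](bigD1 i)//= lerDl.
by apply: sumr_ge0 => i0 _; apply: sumr_ge0.
Qed.

Lemma series_exp_coeff_le_expR (x : R) n : 0 <= x ->
  series (exp_coeff x) n <= expR x.
Proof.
move=> x0; apply: nondecreasing_cvgn_le; last exact: is_cvg_series_exp_coeff.
by apply: nondecreasing_series => k _ _; exact: exp_coeff_ge0.
Qed.

(** The terms of order 0 and 1 of the exponential series are subtracted. In the remaining ones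
    [h ^+ k <= h ^+ 2] because [h <= 1], and the rest is dominated by the series of [expR M], so one
    constant serves all entries. *)
Lemma transition_short_time (S : finType) (q : S -> S -> R) :
  exists2 C, 0 <= C & forall h x y, 0 <= h <= 1 ->
    `|transition q h x y - ((x == y)%:R + h * q x y)| <= C * h ^+ 2.
Proof.
set Q := gen_mx q; pose M : R := \sum_i \sum_j `|Q i j|.
have M0 : 0 <= M by apply: sumr_ge0 => i _; apply: sumr_ge0.
exists (expR M); first exact: expR_ge0.
move=> h x y /andP[h0 h1].
pose a k := h ^+ k / k`!%:R * (Q ^+ k) (enum_rank x) (enum_rank y).
have ale k : `|a k| <= exp_coeff (h * M) k.
  rewrite /a /exp_coeff /= !normrM ger0_norm ?exprn_ge0// ger0_norm ?invr_ge0//.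
  rewrite exprMn [leRHS]mulrAC ler_wpM2l ?mx_exp_entry_le//.
  by rewrite mulr_ge0 ?exprn_ge0 ?invr_ge0.
have acvg : cvgn (series a).
  apply: normed_cvg; apply: (@series_le_cvg _ _ (exp_coeff (h * M))) => //.
  - by move=> n; exact: normr_ge0.
  - by move=> n; apply: exp_coeff_ge0; exact: mulr_ge0.
  - exact: is_cvg_series_exp_coeff.
have a0 : a 0%N = (x == y)%:R.
  by rewrite /a !expr0 fact0 divr1 mul1r mxE (inj_eq enum_rank_inj).
have a1 : a 1%N = h * q x y.
  by rewrite /a !expr1 factS fact0 muln1 divr1 mxE !enum_rankK.
have tail n : `|series a n.+2 - (a 0%N + a 1%N)| <= expR M * h ^+ 2.
  rewrite /series /= big_nat_recl// big_nat_recl// addrA [X in `|X|]addrC addKr.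
  rewrite (le_trans (ler_norm_sum _ _ _))//.
  apply: (@le_trans _ _ (\sum_(0 <= k < n) exp_coeff M k.+2 * h ^+ 2)).
    apply: ler_sum => k _; apply: (le_trans (ale _)).
    rewrite /exp_coeff /= exprMn -[leLHS]mulrA [leLHS]mulrC ler_wpM2l//.
      by rewrite mulr_ge0 ?exprn_ge0 ?invr_ge0.
    exact: ler_wiXn2l.
  rewrite -mulr_suml ler_wpM2r ?exprn_ge0//.
  apply: le_trans (@series_exp_coeff_le_expR M n.+2 M0).
  rewrite /series /= [leRHS]big_nat_recl// big_nat_recl// addrA lerDr.
  by rewrite addr_ge0 ?exp_coeff_ge0.
rewrite -a0 -a1 /transition -/Q -/a.
have cv : `|series a n.+2 - (a 0%N + a 1%N)| @[n --> \oo] -->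
          `|limn (series a) - (a 0%N + a 1%N)|.
  apply: cvg_norm; apply: cvgB; last exact: cvg_cst.
  have : series a @ \oo --> limn (series a) by exact: acvg.
  rewrite -(cvg_shiftn 2%N); under eq_fun do rewrite addn2.
  by [].
rewrite -(cvg_lim _ cv)//; apply: limr_le; first by apply: cvgP cv.
by near=> n; exact: tail.
Unshelve. all: by end_near.
Qed.

End MatrixExponential.

(** * The chain sampled at multiples of a fixed step *)

Section SkeletonChain.
Context {R : realType} {S : finType} {d : measure_display}
  {Omega : measurableType d}.
Variables (q : S -> S -> R) (X : R -> Omega -> S) (P : S -> probability Omega R).
Hypothesis hX : markov_chain q X P.

Let p := transition q.

Lemma measurable_state (t : R) (D : pred S) : 0 <= t ->
  measurable [set w | D (X t w)].
Proof.
move=> t0; rewrite (_ : [set w | _] =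
    \bigcup_(y in [set y | D y]) [set w | X t w = y]).
  apply: fin_bigcup_measurable => [|y _]; last exact: chain_measurable hX t y t0.
  exact: finite_finset.
apply/seteqP; split => [w /= Dw|w [y /= Dy]]; last by move=> ->.
by exists (X t w).
Qed.

Lemma measurable_all_states (t : nat -> R) (D : nat -> pred S) (J : pred nat) :
  (forall i, 0 <= t i) ->
  measurable [set w | forall i, J i -> D i (X (t i) w)].
Proof.
move=> t0; rewrite (_ : [set w | _] =
    \bigcap_(i in [set i | J i]) [set w | D i (X (t i) w)]).
  by apply: bigcap_measurableType => i _; exact: measurable_state.
by apply/seteqP; split => w /= H i Ji; exact: H.
Qed.

Lemma prob_state_split (x : S) (E : set Omega) (t : R) : 0 <= t ->
  measurable E ->
  P x E = (\sum_y P x (E `&` [set w | X t w = y]))%E.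
Proof.
move=> t0 mE; rewrite -(big_enum _ _ _ (fun y => P x (E `&` [set w | X t w = y]))) /=.
rewrite fsbig_seq ?enum_uniq// -measure_fin_bigcup//=.
- congr (P x _); apply/seteqP; split => [w Ew|w [y _ []]//].
  by exists (X t w) => //=; rewrite mem_enum.
- by move=> y z _ _ [w [[_ <-] [_ <-]]].
- by move=> y _; apply: measurableI => //; exact: chain_measurable hX t y t0.
Qed.

(** Taking [k = 0] in the finite-dimensional laws gives the initial state probability 1. This lets
    formulas that prescribe the whole path apply to events that do not mention time 0. *)
Lemma prob_start (x : S) (E : set Omega) : measurable E ->
  P x ([set w | X 0 w = x] `&` E) = P x E.
Proof.
move=> mE; have m0 y : measurable [set w | X 0 w = y].
  exact: chain_measurable hX _ _ (lexx 0).
have px1 : P x [set w | X 0 w = x] = 1%E.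
  have := @chain_finite_dim _ _ _ _ _ _ _ hX 0%N (fun=> 0) (fun=> x) erefl
    (fun _ _ _ => lexx _).
  rewrite big_ord0 => <-; congr (P x _).
  by apply/seteqP; split => w /= H; [move=> _ _|exact: (H 0%N)].
rewrite [in RHS](prob_state_split x (lexx 0) mE) (bigD1 x)//= setIC.
rewrite big1 ?adde0// => y yx; apply/eqP; rewrite eq_le measure_ge0 andbT.
apply: (@le_trans _ _ (P x (~` [set w | X 0 w = x]))); last first.
  by rewrite probability_setC// px1 subee.
apply: le_measure; rewrite ?inE; [exact: measurableI|exact: measurableC|].
by move=> w [_ /= ->] yE; move: yx; rewrite yE eqxx.
Qed.

(* The probability that the chain sampled at the times [0, h, 2 h, ...] avoids
   [B] for the first [m] samples and that the next sample lies in [C]. *)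
Fixpoint taboo (B C : pred S) (h : R) (m : nat) (z : S) : R :=
  if m is m'.+1 then
    if B z then 0 else \sum_y p h z y * taboo B C h m' y
  else (C z)%:R.

(** The Markov property, derived from finite-dimensional laws alone. The prescribed initial path [y]
    makes the induction on [m] work: splitting on the state [z] at time [k.+1 * h] prolongs the path
    by [z] and moves one factor out of [taboo]. *)
Lemma prob_path_taboo (B C : pred S) (h : R) (m k : nat) (y : nat -> S) :
  0 <= h ->
  P (y 0%N) [set w | [/\ forall i, (i <= k)%N -> X (i%:R * h) w = y i,
      forall i, (i < m)%N -> ~~ B (X ((k + i)%:R * h) w) &
      C (X ((k + m)%:R * h) w)]] =
  ((\prod_(i < k) p h (y i) (y i.+1)) * taboo B C h m (y k))%:E.
Proof.
move=> h0; have ih0 i : 0 <= i%:R * h by rewrite mulr_ge0.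
elim: m k y => [|m IH] k y.
  case: (boolP (C (y k))) => /= [Cy|/negbTE nCy]; last first.
    rewrite nCy mulr0; apply: (eq_trans _ (measure0 (P (y 0%N)))); congr (P _ _).
    by apply/seteqP; split => // w [/= H _]; rewrite addn0 H// nCy.
  have := @chain_finite_dim _ _ _ _ _ _ _ hX k (fun i => i%:R * h) y.
  rewrite mul0r => /(_ erefl) H; rewrite Cy mulr1.
  rewrite [in RHS](eq_bigr (fun i : 'I_k =>
      transition q (i.+1%:R * h - i%:R * h) (y i) (y i.+1))); last first.
    by move=> i _; rewrite -mulrBl -natrB// subSnn mul1r.
  rewrite -H; last by move=> i j ij; rewrite ler_wpM2r// ler_nat.
  congr (P _ _); apply/seteqP; split => w /=; first by case.
  by move=> Hw; split=> //; rewrite addn0 Hw.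
rewrite /=; case: ifPn => [By|nBy].
  rewrite mulr0; apply: (eq_trans _ (measure0 (P (y 0%N)))); congr (P _ _).
  apply/seteqP; split => // w [/= H /(_ 0%N isT) H' _].
  by move: H'; rewrite addn0 H// By.
rewrite (prob_state_split _ (ih0 k.+1)); last first.
  rewrite (_ : [set w | _] =
    [set w | forall i, (i <= k)%N -> (pred1 (y i)) (X (i%:R * h) w)] `&`
    [set w | forall i, (i < m.+1)%N -> (predC B) (X ((k + i)%:R * h) w)] `&`
    [set w | C (X ((k + m.+1)%:R * h) w)]).
    apply: measurableI; last exact: measurable_state.
    apply: measurableI.
      exact: (@measurable_all_states _ (fun i => pred1 (y i)) (fun i => (i <= k)%N)).
    apply: (@measurable_all_states (fun i => (k + i)%:R * h) (fun=> predC B)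
      (fun i => (i < m.+1)%N)) => i; exact: ih0.
  apply/seteqP; split => w /=.
    by move=> [H1 H2 H3]; split=> //; split=> // i ik; apply/eqP; exact: H1.
  by move=> [[H1 H2] H3]; split=> // i ik; apply/eqP; exact: H1.
rewrite mulr_sumr -sumEFin; apply: eq_bigr => z _.
pose y' i := if (i <= k)%N then y i else z.
have y'k : y' k.+1 = z by rewrite /y' ltnn.
have y'le i : (i <= k)%N -> y' i = y i by rewrite /y' => ->.
have := IH k.+1 y'; rewrite y'k big_ord_recr /= y'k (y'le k)// (y'le 0%N)//.
rewrite (eq_bigr (fun i : 'I_k => p h (y i) (y i.+1))); last first.
  by move=> i _; rewrite !y'le// ltnW.
rewrite mulrA => <-; congr (P _ _).
apply/seteqP; split => w /=.
  move=> [[H1 H2 H3] H4]; split.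
  - move=> i; rewrite leq_eqVlt ltnS => /orP[/eqP ->|ik]; first by rewrite y'k.
    by rewrite y'le// H1.
  - by move=> i im; rewrite addSnnS; exact: H2.
  - by rewrite addSnnS.
move=> [H1 H2 H3]; split; last by rewrite H1.
split.
- by move=> i ik; rewrite H1 ?leqW// y'le.
- case=> [_|i im]; first by rewrite addn0 H1// y'le.
  by rewrite -addSnnS; exact: H2.
- by rewrite -addSnnS.
Qed.

Lemma prob_taboo (B C : pred S) (h : R) (m : nat) (x : S) : 0 <= h ->
  P x ([set w | forall i, (i < m)%N -> ~~ B (X (i%:R * h) w)] `&`
       [set w | C (X (m%:R * h) w)]) = (taboo B C h m x)%:E.
Proof.
move=> h0; have ih0 i : 0 <= i%:R * h by rewrite mulr_ge0.
rewrite -prob_start; last first.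
  by apply: measurableI; [exact: (@measurable_all_states _ (fun=> predC B)
      (fun i => (i < m)%N))|
    exact: measurable_state].
have := @prob_path_taboo B C h m 0%N (fun=> x) h0.
rewrite big_ord0 mul1r => <-; congr (P x _); apply/seteqP; split => w /=.
  move=> [H1 [H2 H3]]; split=> // i; rewrite leqn0 => /eqP ->.
  by rewrite mul0r.
by move=> [/(_ 0%N isT) H1 H2 H3]; rewrite mul0r in H1.
Qed.

(** The case of [prob_taboo] with nothing to avoid and a single step of length [t]. *)
Lemma prob_state_in (C : pred S) (t : R) (x : S) : 0 <= t ->
  P x [set w | C (X t w)] = (\sum_y p t x y * (C y)%:R)%:E.
Proof.
move=> t0; have /= := @prob_taboo pred0 C t 1%N x t0; rewrite /= => <-.
by rewrite mul1r; congr (P x _); apply/seteqP; split => w //= [].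
Qed.

(** Stochasticity of [p] is read off from the process: by [prob_state_in] its entries are
    probabilities. *)
Lemma transition_ge0 (t : R) x y : 0 <= t -> 0 <= p t x y.
Proof.
move=> t0; rewrite -lee_fin.
have : (0 <= P x [set w | pred1 y (X t w)])%E by exact: measure_ge0.
rewrite prob_state_in// (bigD1 y)//= eqxx mulr1 big1 ?addr0// => z /negbTE zy.
by rewrite zy mulr0.
Qed.

Lemma transition_sum1 (t : R) x : 0 <= t -> \sum_y p t x y = 1.
Proof.
move=> t0; apply: EFin_inj; rewrite -[RHS](probability_setT (P x)).
have := @prob_state_in predT t x t0.
rewrite (eq_bigr (p t x)) => [<-|y _]; last by rewrite mulr1.
by congr (P x _); apply/seteqP; split.
Qed.

End SkeletonChain.

(** * Short-time expectations, and measurability of hitting times *)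

Section HittingTimes.
Context {R : realType} {S : finType} {d : measure_display}
  {Omega : measurableType d}.
Variables (q : S -> S -> R) (X : R -> Omega -> S) (P : S -> probability Omega R).
Hypothesis hX : markov_chain q X P.

Definition generator (f : S -> R) (x : S) : R := \sum_y q x y * f y.

(** The constant is chosen before [f], since [transition_contraction] applies the bound to a
    function that changes at every step. *)
Lemma expectation_short_time : exists2 C, 0 <= C &
  forall h f x, 0 <= h <= 1 ->
    `|\sum_y transition q h x y * f y - (f x + h * generator f x)|
      <= C * h ^+ 2 * \sum_y `|f y|.
Proof.
have [C C0 HC] := transition_short_time q; exists C => // h f x h01.
have -> : \sum_y transition q h x y * f y - (f x + h * generator f x) =
    \sum_y (transition q h x y - ((x == y)%:R + h * q x y)) * f y.
  have -> : f x = \sum_y (x == y)%:R * f y.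
    rewrite (bigD1 x)//= eqxx mul1r big1 ?addr0// => y.
    by rewrite eq_sym => /negbTE ->; rewrite mul0r.
  rewrite /generator mulr_sumr -big_split -sumrB; apply: eq_bigr => y _ /=.
  by ring.
rewrite mulr_sumr (le_trans (ler_norm_sum _ _ _))//; apply: ler_sum => y _.
by rewrite normrM ler_wpM2r// HC.
Qed.

Lemma expectation_cst (t : R) (f : S -> R) c x : 0 <= t ->
  \sum_y transition q t x y * (f y + c) = \sum_y transition q t x y * f y + c.
Proof.
move=> t0; rewrite -[X in _ + X]mul1r -(transition_sum1 hX x t0) mulr_suml.
by rewrite -big_split; apply: eq_bigr => y _; rewrite mulrDr.
Qed.

Lemma taboo_ge0 B C (h : R) m x : 0 <= h -> 0 <= taboo q B C h m x.
Proof.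
move=> h0; elim: m x => [|m IH] x /=; first by rewrite ler0n.
case: ifP => // _; apply: sumr_ge0 => y _.
by rewrite mulr_ge0// (transition_ge0 hX).
Qed.

Lemma taboo_le1 B C (h : R) m x : 0 <= h -> taboo q B C h m x <= 1.
Proof.
move=> h0; elim: m x => [|m IH] x /=; first by case: (C x).
case: ifP => // _; rewrite -(transition_sum1 hX x h0); apply: ler_sum => y _.
by rewrite ler_piMr ?(transition_ge0 hX).
Qed.

Variable B : pred S.

Lemma hitting_time_ge0 w : (0 <= hitting_time X B w)%E.
Proof. by apply: le_ereal_inf_tmp => _ [t [t0 _] <-]; rewrite lee_fin. Qed.

Lemma hitting_time_le (t : R) w : 0 <= t -> B (X t w) ->
  (hitting_time X B w <= t%:E)%E.
Proof. by move=> t0 Bt; apply: ereal_inf_lbound; exists t. Qed.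

(* By right continuity it suffices to look at dyadic times. *)
Lemma hitting_time_lt_dyadic (T : R) : 0 < T ->
  [set w | (hitting_time X B w < T%:E)%E] =
  \bigcup_m [set w | exists2 i, (i < 2 ^ m)%N & B (X (i%:R * (T / 2 ^+ m)) w)].
Proof.
move=> T0; have two0 m : 0 < 2 ^+ m :> R by rewrite exprn_gt0.
apply/seteqP; split => w /=; last first.
  move=> [m _ [i im Bi]]; apply: (le_lt_trans (hitting_time_le _ Bi)).
    by rewrite mulr_ge0// divr_ge0// ltW.
  rewrite lte_fin mulrCA gtr_pMr// ltr_pdivrMr// mul1r -natrX ltr_nat//.
move=> /ereal_inf_lt[_ [t [t0 Bt] <-]]; rewrite lte_fin => tT.
have [e e0 He] : exists2 e, 0 < e &
    forall s, t < s -> s < t + e -> s < T /\ X s w = X t w.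
  have : \forall s \near t^'+, s < T /\ X s w = X t w.
    near=> s; split; near: s; first exact: nbhs_right_lt.
    exact: chain_right_continuous hX t w t0.
  move=> /nbhs_ballP[e /= e0 He]; exists e => // s ts se; apply: He => //.
  by rewrite /ball /= ltr_distlC ltrBlDr (lt_trans ts)/= ?ltrDl.
(* Since [2 ^ m > m], the mesh [h] is below [e]. The first grid point strictly after [t] then lies
   in the window where the state is still [X t w]. *)
pose m := Num.bound (T / e); pose h := T / 2 ^+ m.
have h0 : 0 < h by rewrite divr_gt0.
have he : h < e.
  rewrite ltr_pdivrMr// mulrC -ltr_pdivrMr//.
  apply: (lt_le_trans (archi_boundP _)); first by rewrite divr_ge0// ltW.
  by rewrite -natrX ler_nat ltnW// ltn_expl.
have /andP[t1 t2] := truncn_itv (divr_ge0 t0 (ltW h0)).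
set i := (Num.truncn (t / h)).+1 in t2.
have ti : t < i%:R * h by rewrite -ltr_pdivrMr.
have [iT iX] : i%:R * h < T /\ X (i%:R * h) w = X t w.
  apply: He => //; rewrite /i -natr1 mulrDl mul1r.
  by rewrite ler_ltD// -ler_pdivlMr.
exists m => //; exists i; last by rewrite iX.
by move: iT; rewrite /h mulrCA gtr_pMr// ltr_pdivrMr// mul1r -natrX ltr_nat.
Unshelve. all: by end_near.
Qed.

Lemma measurable_hitting_time_lt (T : \bar R) :
  measurable [set w | (hitting_time X B w < T)%E].
Proof.
have mfin (t : R) : measurable [set w | (hitting_time X B w < t%:E)%E].
  have [t0|t0] := ltP 0 t; last first.
    rewrite (_ : [set w | _] = set0)//; apply/seteqP; split => // w /=.
    by apply/negP; rewrite -leNgt (le_trans _ (hitting_time_ge0 w)).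
  rewrite hitting_time_lt_dyadic//; apply: bigcup_measurable => m _.
  rewrite (_ : [set w | _] = \bigcup_(i in [set i | (i < 2 ^ m)%N])
      [set w | B (X (i%:R * (t / 2 ^+ m)) w)]).
    apply: bigcup_measurable => i _; apply: (measurable_state hX).
    by rewrite mulr_ge0// divr_ge0 ?exprn_ge0// ltW.
  by apply/seteqP; split => w /= [i im Bi]; exists i.
case: T => [t| |]; first exact: mfin.
- rewrite (_ : [set w | _] =
      \bigcup_k [set w | (hitting_time X B w < k%:R%:E)%E]).
    by apply: bigcup_measurable => k _; exact: mfin.
  apply/seteqP; split => w /=; last first.
    by move=> [k _ /lt_le_trans]; apply; rewrite leey.
  move=> hlt; have := hitting_time_ge0 w; move: hlt.
  case E: (hitting_time X B w) => [r| |]// _; rewrite lee_fin => r0.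
  by exists (Num.bound r) => //=; rewrite E lte_fin; exact: archi_boundP.
- rewrite (_ : [set w | _] = set0)//; apply/seteqP; split => // w /=.
  by rewrite ltNge leNye.
Qed.

Lemma measurable_hitting_time :
  measurable_fun [set: Omega] (hitting_time X B).
Proof.
move=> mT; apply: (measurability _ (ErealGenInftyO.measurableE R)) => //.
move=> _ /= [_ [r ->] <-]; rewrite setTI.
rewrite (_ : _ @^-1` _ = [set w | (hitting_time X B w < r%:E)%E]).
  exact: measurable_hitting_time_lt.
by apply/seteqP; split => w /=; rewrite in_itv.
Qed.

End HittingTimes.

(** * Drift conditions that control hitting times *)

Section DriftBounds.
Context {R : realType} {S : finType} {d : measure_display}
  {Omega : measurableType d}.
Variables (q : S -> S -> R) (X : R -> Omega -> S) (P : S -> probability Omega R).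
Hypothesis hX : markov_chain q X P.
Variable B : pred S.

Lemma prob_skeleton_hits (h : R) (m : nat) x : 0 <= h ->
  P x [set w | exists2 i, (i < m)%N & B (X (i%:R * h) w)] =
  (1 - taboo q B predT h m x)%:E.
Proof.
move=> h0; rewrite EFinB -(prob_taboo hX _ _ _ _ h0) -probability_setC.
  congr (P x _); apply/seteqP; split => w /=.
    by move=> [i im Bi] [/(_ i im)]; rewrite Bi.
  move=> H; apply: contrapT => nE; apply: H; split => // i im.
  by apply/negP => Bi; apply: nE; exists i.
apply: measurableI; last by apply: (measurable_state hX); rewrite mulr_ge0.
apply: (@measurable_all_states _ _ _ _ _ _ _ hX (fun i => i%:R * h)
  (fun=> predC B) (fun i => (i < m)%N)) => i.
by rewrite mulr_ge0.
Qed.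

(* Supermartingale argument: [phi] increases at rate at most [eps] until [B]
   is hit, where it is at least [1]. *)
Lemma prob_hitting_time_lt (phi : S -> R) (eps T : R) x :
  (forall y, 0 <= phi y) -> (forall y, B y -> 1 <= phi y) ->
  0 <= eps -> (forall y, ~~ B y -> generator q phi y <= eps) -> 0 < T ->
  (P x [set w | (hitting_time X B w < T%:E)%E] <= (phi x + eps * T)%:E)%E.
Proof.
move=> phi0 phi1 eps0 phi_gen T0.
have [C C0 HC] := expectation_short_time q.
pose K := C * \sum_y `|phi y|.
have K0 : 0 <= K by rewrite mulr_ge0// sumr_ge0.
(* The bound for the sampled chain, by conditioning on the first step. [1 - taboo] is the
   probability that one of the first [m] samples lies in [B]. *)
have step h m y : 0 <= h <= 1 ->
    1 - taboo q B predT h m y <= phi y + m%:R * (h * eps + K * h ^+ 2).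
  move=> /[dup] h01 /andP[h0 h1].
  have e0 : 0 <= h * eps + K * h ^+ 2.
    by apply: addr_ge0; apply: mulr_ge0 => //; exact: exprn_ge0.
  elim: m y => [|m IH] y /=; first by rewrite subrr mul0r addr0.
  case: ifPn => [By|nBy].
    by rewrite subr0 (le_trans (phi1 _ By))// lerDl mulr_ge0.
  apply: (@le_trans _ _ (\sum_z transition q h y z *
      (phi z + m%:R * (h * eps + K * h ^+ 2)))).
    rewrite -{1}(transition_sum1 hX y h0) -sumrB; apply: ler_sum => z _.
    rewrite -{1}[transition q h y z]mulr1 -mulrBr ler_wpM2l//.
    exact: (transition_ge0 hX).
  rewrite (expectation_cst hX)// -natr1 mulrDl mul1r addrCA [leLHS]addrC lerD2l.
  have := HC h phi y h01; rewrite ler_norml => /andP[_].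
  rewrite lerBlDl => /le_trans; apply; rewrite -addrA lerD2l.
  by rewrite mulrAC -/K lerD2r ler_wpM2l// phi_gen.
(* Now the mesh tends to 0 along [T / 2 ^+ m]. The events [A m] increase to the hitting event; over
   the [2 ^ m] steps the drift adds up to [eps * T] and the expansion errors to
   [K * T ^+ 2 / 2 ^+ m], which vanishes. *)
rewrite (hitting_time_lt_dyadic hX)//; apply/lee_addgt0Pr => e e0.
rewrite -EFinD; set A := fun m : nat => [set w | _].
have hge0 m : 0 <= T / 2 ^+ m by rewrite divr_ge0 ?exprn_ge0 ?ltW.
have mA m : measurable (A m).
  rewrite (_ : A m = \bigcup_(i in [set i | (i < 2 ^ m)%N])
      [set w | B (X (i%:R * (T / 2 ^+ m)) w)]).
    apply: bigcup_measurable => i _; apply: (measurable_state hX).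
    exact: mulr_ge0.
  by apply/seteqP; split => w /= [i im Bi]; exists i.
have Amono : {homo A : m k / (m <= k)%N >-> (m <= k)%O}.
  apply/nondecreasing_seqP => m; apply/subsetPset => w [i im Bi].
  exists i.*2; first by rewrite expnS mul2n ltn_double.
  rewrite (_ : _ * _ = i%:R * (T / 2 ^+ m))// -muln2 natrM exprS.
  by field; rewrite expf_neq0.
have Acvg := nondecreasing_cvg_mu (mu := P x) mA
  (bigcup_measurable (fun k _ => mA k)) Amono.
rewrite -(cvg_lim _ Acvg)//; apply: lime_le; first by apply: cvgP Acvg.
have cvg0 (c : R) : c * 2^-1 ^+ m @[m --> \oo] --> 0.
  by apply: (@cvg_geometric R c 2^-1); rewrite ger0_norm// invf_lt1// ltr1n.
near=> m.
have Tm : T / 2 ^+ m <= 1.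
  rewrite -exprVn; near: m; exact: (cvgr_le _ (cvg0 T) _ ltr01).
rewrite /= /A prob_skeleton_hits// lee_fin.
apply: (le_trans (step _ _ _ _)); first by rewrite hge0.
rewrite -addrA lerD2l mulrDr natrX mulrA [_ * (T / _)]mulrC divfK ?expf_neq0//.
rewrite [eps * T]mulrC lerD2l.
rewrite (_ : _ * _ = (K * T ^+ 2) * 2^-1 ^+ m); last first.
  by rewrite exprVn; field; rewrite expf_neq0.
near: m; exact: (cvgr_le _ (cvg0 _) _ e0).
Unshelve. all: by end_near.
Qed.

(** The sampled chain reaches [B] no earlier than the process, and its expected hitting time is [h]
    times the sum of its survival probabilities. For a fixed [h] with [K * h <= 1 / 2], each step
    outside [B] lowers the mean of [psi] by at least [h - K * h ^+ 2 >= h / 2]; the factor 2 is the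
    price of not letting [h] tend to 0. *)
Lemma integral_hitting_time_le (psi : S -> R) x :
  (forall y, 0 <= psi y) -> (forall y, ~~ B y -> generator q psi y <= -1) ->
  (\int[P x]_w hitting_time X B w <= (2 * psi x)%:E)%E.
Proof.
move=> psi0 psi_gen.
have [C C0 HC] := expectation_short_time q.
pose K := C * \sum_y `|psi y|.
have K0 : 0 <= K by rewrite mulr_ge0// sumr_ge0.
pose h := (1 + 2 * K)^-1.
have K1 : 0 < 1 + 2 * K by lra.
have h0 : 0 < h by rewrite invr_gt0.
have h1 : h <= 1 by rewrite invf_le1//; lra.
have Kh : K * h <= 2^-1 by rewrite ler_pdivrMr//; lra.
have ih0 i : 0 <= i%:R * h by rewrite mulr_ge0// ltW.
have sum_le m y : \sum_(0 <= i < m) h / 2 * taboo q B predT h i.+1 y <= psi y.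
  elim: m y => [|m IH] y; first by rewrite big_nil.
  case: (boolP (B y)) => By.
    by rewrite big1 => [|i _]; [exact: psi0|rewrite /= By mulr0].
  rewrite big_nat_recl//= (negbTE By).
  apply: (@le_trans _ _ (h / 2 + \sum_z transition q h y z * psi z)).
    rewrite lerD//.
      by under eq_bigr do rewrite mulr1; rewrite (transition_sum1 hX _ (ltW h0)) mulr1.
    under eq_bigr do rewrite mulr_sumr.
    rewrite exchange_big /=; apply: ler_sum => z _.
    under eq_bigr do rewrite mulrCA.
    by rewrite -mulr_sumr ler_wpM2l ?IH ?(transition_ge0 hX) ?ltW.
  have := HC h psi y; rewrite ltW//= => /(_ h1); rewrite ler_norml => /andP[_].
  rewrite mulrAC -/K => H; have := psi_gen _ By; rewrite -(ler_pM2l h0) => H2.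
  have : K * h ^+ 2 <= h / 2 by rewrite expr2 mulrA mulrC ler_pM2l.
  lra.
pose A i := [set w | forall j, (j <= i)%N -> ~~ B (X (j%:R * h) w)].
have mA i : measurable (A i).
  exact: (@measurable_all_states _ _ _ _ _ _ _ hX (fun j => j%:R * h)
    (fun=> predC B) (fun j => (j <= i)%N) ih0).
have PA i : P x (A i) = (taboo q B predT h i.+1 x)%:E.
  rewrite -(prob_taboo hX _ _ _ _ (ltW h0)); congr (P x _).
  apply/seteqP; split => w /=; first by move=> H; split => // j; exact: H.
  by move=> [H _] j; exact: H.
have term0 i w : (0 <= (h * \1_(A i) w)%:E)%E.
  by rewrite lee_fin indicE mulr_ge0 ?ler0n// ltW.
apply: (@le_trans _ _ (\int[P x]_w (\sum_(0 <= i <oo) (h * \1_(A i) w)%:E))%E).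
  apply: ge0_le_integral => //.
  - by move=> w _; exact: hitting_time_ge0.
  - exact: measurable_hitting_time hX B.
  - apply: ge0_emeasurable_sum => [//|i _].
    apply/measurable_EFinP; exact: measurable_funM.
  move=> w _.
  have [[k Bk]|nB] := pselect (exists k, B (X (k%:R * h) w)).
    pose m := ex_minn (ex_intro (fun k => B (X (k%:R * h) w)) k Bk).
    have [Bm mmin] : B (X (m%:R * h) w) /\
        forall j, B (X (j%:R * h) w) -> (m <= j)%N.
      by rewrite /m; case: ex_minnP.
    apply: (le_trans (hitting_time_le (ih0 m) Bm)).
    apply: le_trans (@nneseries_lim_ge _ _ xpredT 0%N m _) => //.
    rewrite (eq_big_nat _ _ (F2 := fun=> h%:E)).
      rewrite sumEFin lee_fin sumr_const_nat subn0.
      by rewrite mulr_natl.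
    move=> i /andP[_ im]; rewrite indicE mem_set ?mulr1// => j ji.
    by apply/negP => /mmin; rewrite leqNgt (leq_ltn_trans ji).
  rewrite (_ : (\sum_(0 <= i <oo) _)%E = +oo%E) ?leey//.
  apply/eqyP => r r0; pose m := Num.bound (r / h).
  apply: le_trans (@nneseries_lim_ge _ _ xpredT 0%N m _) => //.
  rewrite (eq_big_nat _ _ (F2 := fun=> h%:E)) => [|i _].
    rewrite sumEFin lee_fin sumr_const_nat subn0 -mulr_natl.
    by rewrite -ler_pdivrMr// ltW// archi_boundP// divr_ge0 ?ltW.
  rewrite indicE mem_set ?mulr1// => j ji; apply/negP => Bj.
  by apply: nB; exists j.
rewrite integral_nneseries//; last first.
move=> i; apply/measurable_EFinP; exact: measurable_funM.
have int_term i : (\int[P x]_w (h * \1_(A i) w)%:E)%E =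
    (h * taboo q B predT h i.+1 x)%:E.
  rewrite (integralZl_indic _ (fun=> A i))//; last first.
    by move=> hlt0; move: (lt_trans h0 hlt0); rewrite ltxx.
  by rewrite integral_indic// setIT EFinM; congr (_ * _)%E; exact: PA.
rewrite (eq_eseriesr (fun i _ => int_term i)).
apply: lime_le.
  by apply: is_cvg_nneseries => i _ _; rewrite lee_fin mulr_ge0 ?(taboo_ge0 hX) ?(ltW h0).
near=> m; rewrite sumEFin lee_fin.
rewrite -ler_pdivrMl// mulr_sumr; apply: le_trans (sum_le m x).
by apply: ler_sum => i _; rewrite mulrA [2^-1 * h]mulrC.
Unshelve. all: by end_near.
Qed.

End DriftBounds.

(** * Upper and lower bounds on mixing times *)

Section MixingTime.
Context {R : realType} {S : finType} {d : measure_display}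
  {Omega : measurableType d}.
Variables (q : S -> S -> R) (X : R -> Omega -> S) (P : S -> probability Omega R).
Hypothesis hX : markov_chain q X P.

(** The semigroup property: both sides are the probability of the same event, seen as [m] short
    steps or as one long step. *)
Lemma taboo_pred0 (D : pred S) (h : R) m x : 0 <= h ->
  taboo q pred0 D h m x = \sum_y transition q (m%:R * h) x y * (D y)%:R.
Proof.
move=> h0; apply: EFin_inj; rewrite -(prob_taboo hX _ _ _ _ h0).
rewrite -(prob_state_in hX) ?mulr_ge0//; congr (P x _).
by apply/seteqP; split => w /=; [case|].
Qed.

(** The indicator of [D] varies by at most 1 along an edge. Each of [m.+1] steps of length
    [t / m.+1] multiplies this by [1 - c * h <= expR (- (c * h))] and adds an error of order
    [h ^+ 2]; the errors sum to order [1 / m.+1]. *)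
Lemma transition_contraction (e : rel S) (c h1 : R) :
  0 <= c -> 0 < h1 ->
  (forall (g : S -> R) L h, 0 <= h <= h1 ->
    (forall x y, e x y -> `|g x - g y| <= L) ->
    forall x y, e x y ->
    `|(g x + h * generator q g x) - (g y + h * generator q g y)|
      <= (1 - c * h) * L) ->
  forall (D : pred S) t x y, 0 <= t -> e x y ->
    `|\sum_z transition q t x z * (D z)%:R -
      \sum_z transition q t y z * (D z)%:R| <= expR (- (c * t)).
Proof.
move=> c0 h1_gt0 contr D t x y t0 exy.
have [C C0 HC] := expectation_short_time q.
(* The iterates take values in [0, 1], so the sum of their absolute values is at most [#|S|]; the
   factor 2 accounts for the two ends of an edge. *)
pose K := 2 * (C * #|S|%:R).
have K0 : 0 <= K by rewrite !mulr_ge0.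
have step h k : 0 <= h <= Order.min 1 h1 -> c * h <= 1 ->
    forall x y, e x y ->
    `|taboo q pred0 D h k x - taboo q pred0 D h k y| <=
      expR (- (c * h * k%:R)) + k%:R * (K * h ^+ 2).
  rewrite le_min => /and3P[h0 hle1 hleh1] ch1.
  have h01 : 0 <= h <= 1 by rewrite h0.
  elim: k => [|k IH] {exy}x {}y exy.
    rewrite mulr0 oppr0 expR0 mul0r addr0 /=.
    by case: (D x); case: (D y); rewrite ?subrr ?subr0 ?sub0r ?normrN ?normr0 ?normr1.
  set u := taboo q pred0 D h k in IH *.
  have u_err z : `|taboo q pred0 D h k.+1 z - (u z + h * generator q u z)|
      <= K * h ^+ 2 / 2.
    apply: (le_trans (HC h u z h01)).
    rewrite /K (_ : _ / 2 = C * h ^+ 2 * #|S|%:R); last by field.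
    rewrite ler_wpM2l ?mulr_ge0 ?exprn_ge0// -sum1_card natr_sum.
    apply: ler_sum => y' _; rewrite ger0_norm ?(taboo_ge0 hX)//.
    exact: (taboo_le1 hX).
  have := contr u _ h _ IH x y exy; rewrite h0 hleh1 => /(_ isT).
  have := u_err x; have := u_err y.
  set a := taboo _ _ _ _ _ _; set b := taboo _ _ _ _ _ _.
  set gx := u x + _; set gy := u y + _ => Hy Hx Hxy.
  apply: (@le_trans _ _ ((1 - c * h) * (expR (- (c * h * k%:R)) +
      k%:R * (K * h ^+ 2)) + K * h ^+ 2)).
    have -> : b - a = (b - gx) + (gx - gy) - (a - gy) by ring.
    rewrite (le_trans (ler_normB _ _))//.
    have := ler_normD (b - gx) (gx - gy); lra.
  rewrite mulrDr -addrA -natr1 [in leRHS]mulrDl mul1r lerD//.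
    rewrite mulrDr mulr1 opprD expRD mulrC ler_wpM2l ?expR_ge0//.
    exact: expR_ge1Dx.
  rewrite lerD2r ler_piMl//; first by rewrite !mulr_ge0 ?exprn_ge0.
  by rewrite lerBlDr lerDl mulr_ge0.
have main m : t * m.+1%:R^-1 <= Order.min 1 h1 -> c * t * m.+1%:R^-1 <= 1 ->
    `|\sum_z transition q t x z * (D z)%:R -
      \sum_z transition q t y z * (D z)%:R| <=
    expR (- (c * t)) + K * t ^+ 2 * m.+1%:R^-1.
  move=> tm; rewrite -mulrA => ctm.
  have h0 : 0 <= t / m.+1%:R by rewrite divr_ge0.
  have := step (t / m.+1%:R) m.+1 _ _ x y exy.
  rewrite h0 tm !(taboo_pred0 _ _ _ h0) [m.+1%:R * (t / _)]mulrC divfK//.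
  move=> /(_ isT ctm).
  rewrite (_ : c * (t / _) * _ = c * t); last by rewrite mulrA divfK.
  by rewrite (_ : m.+1%:R * _ = K * t ^+ 2 / m.+1%:R)//; field.
apply/ler_addgt0Pr => eps eps0.
have cvg0 (a : R) : a * m.+1%:R^-1 @[m --> \oo] --> 0.
  by rewrite -(mulr0 a); apply: cvgM; [exact: cvg_cst|exact: cvg_harmonic].
have min_gt0 : 0 < Order.min 1 h1 by rewrite lt_min ltr01.
near \oo => m; apply: (le_trans (main m _ _)).
- near: m; exact: (cvgr_le _ (cvg0 t) _ min_gt0).
- near: m; exact: (cvgr_le _ (cvg0 (c * t)) _ ltr01).
- rewrite lerD2l; near: m; exact: (cvgr_le _ (cvg0 (K * t ^+ 2)) _ eps0).
Unshelve. all: by end_near.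
Qed.

Variable pi : S -> R.
Hypothesis hpi : stationary q pi.

(** By stationarity the [pi]-mass of [Gamma] is the [pi]-average over starting points [y] of the
    probability of being in [Gamma] at time [t], so comparing pairs of starting points suffices. *)
Lemma distance_to_stationarity_le (t delta : R) : 0 <= t -> 0 <= delta ->
  (forall (D : pred S) x y, `|\sum_z transition q t x z * (D z)%:R -
    \sum_z transition q t y z * (D z)%:R| <= delta) ->
  distance_to_stationarity X P pi t <= delta.
Proof.
move=> t0 delta0 H; have [pi0 pi1 piP] := hpi.
apply: bigmax_le => // x _; apply: bigmax_le => // Gamma _.
rewrite (prob_state_in hX (mem Gamma))//=.
set a := fun x => \sum_y transition q t x y * (y \in Gamma)%:R.
rewrite -/(a x).
have -> : \sum_(y in Gamma) pi y = \sum_y pi y * a y.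
  under [RHS]eq_bigr do rewrite mulr_sumr.
  rewrite exchange_big /= big_mkcond; apply: eq_bigr => y _.
  under eq_bigr do rewrite mulrA.
  by rewrite -mulr_suml piP//; case: (y \in Gamma); rewrite ?mulr1 ?mulr0.
rewrite -[a x]mul1r -pi1 mulr_suml -sumrB (le_trans (ler_norm_sum _ _ _))//.
rewrite -[delta]mul1r -pi1 mulr_suml; apply: ler_sum => y _.
by rewrite -mulrBr normrM ger0_norm// ler_wpM2l// H.
Qed.

Lemma mixing_time_le (t : R) : 0 <= t ->
  distance_to_stationarity X P pi t <= 4^-1 -> (mixing_time X P pi <= t%:E)%E.
Proof. by move=> t0 dt; apply: ereal_inf_lbound; exists t. Qed.

(** If the chain were mixed at some [t < T], then [D] and [E] would each have [pi]-mass at most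
    [1 / 4 + 1 / 10]. They cover the space, so these masses add up to at least 1. *)
Lemma mixing_time_ge (T : R) (D E : pred S) x y :
  (forall z, D z || E z) ->
  (forall t, 0 <= t < T ->
    (P x [set w | D (X t w)] <= (10^-1)%:E)%E /\
    (P y [set w | E (X t w)] <= (10^-1)%:E)%E) ->
  (T%:E <= mixing_time X P pi)%E.
Proof.
move=> DE H; have [pi0 pi1 _] := hpi.
apply: le_ereal_inf_tmp => _ [t [t0 dt] <-]; rewrite lee_fin leNgt.
apply/negP => tT; have := H t; rewrite t0 tT => /(_ isT) [Dx Ey].
have pi_le (z : S) (C : pred S) : (P z [set w | C (X t w)] <= (10^-1)%:E)%E ->
    \sum_z pi z * (C z)%:R <= 4^-1 + 10^-1.
  move=> PC; pose Gamma := [set z | C z]%SET.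
  have : `|fine (P z [set w | X t w \in Gamma]) - \sum_(y in Gamma) pi y| <= 4^-1.
    apply: le_trans dt; apply: le_trans (le_bigmax _ _ z).
    exact: (le_trans _ (le_bigmax _ _ Gamma)).
  have -> : [set w | X t w \in Gamma] = [set w | C (X t w)].
    by apply/seteqP; split => w; rewrite /= inE.
  have -> : \sum_(y in Gamma) pi y = \sum_z pi z * (C z)%:R.
    rewrite big_mkcond; apply: eq_bigr => z' _.
    by rewrite inE; case: (C z'); rewrite ?mulr1 ?mulr0.
  move: PC; rewrite (prob_state_in hX)//= lee_fin ler_norml => PC /andP[].
  by rewrite lerBrDl => H1 _; lra.
have := lerD (pi_le _ _ Dx) (pi_le _ _ Ey).
rewrite -big_split /=.
have : 1 <= \sum_z (pi z * (D z)%:R + pi z * (E z)%:R).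
  rewrite -[leLHS]pi1; apply: ler_sum => z _; move: (DE z); case: (D z) => /= [_|->].
    by rewrite mulr1 lerDl mulr_ge0.
  by rewrite mulr0 add0r mulr1.
lra.
Qed.

End MixingTime.

(** * The dynamics on the complete graph in terms of opinion counts *)

Section CompleteGraph.
Context {R : realType}.
Variables (alpha : R) (n : nat).

Implicit Types (x y : config 'I_n) (u v : 'I_n) (b : bool).

Definition count b x : nat := #|[pred v | x v == b]|.

(* The rate at which a node flips when [k] nodes hold the other opinion. *)
Definition rate (k : nat) : R :=
  alpha / 2 + (1 - alpha) * (k%:R / n.-1%:R) ^+ 2.

Lemma count_true x : count true x = ones x.
Proof. by apply: eq_card => v; rewrite !inE eqb_id. Qed.

Lemma countC b x : (count b x + count (~~ b) x)%N = n.
Proof.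
rewrite -[RHS](card_ord n) -(cardC [pred v | x v == b]); congr addn.
by apply: eq_card => v; rewrite !inE; case: b (x v) => [] [].
Qed.

Lemma flipK x v : flip (flip x v) v = x.
Proof. by apply/ffunP => u; rewrite !ffunE; case: eqP => // _; rewrite negbK. Qed.

Lemma flip_neq x v : flip x v != x.
Proof. by apply/eqP => /ffunP/(_ v); rewrite ffunE eqxx; case: (x v). Qed.

Lemma flipC x u v : flip (flip x u) v = flip (flip x v) u.
Proof.
apply/ffunP => w; rewrite !ffunE.
by case: (w == v); case: (w == u).
Qed.

Lemma count_flip b x v :
  count b (flip x v) = if x v == b then (count b x).-1 else (count b x).+1.
Proof.
rewrite /count (cardD1 v) [in RHS](cardD1 v) !inE ffunE eqxx.
have -> : #|[predD1 [pred u | flip x v u == b] & v]| =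
    #|[predD1 [pred u | x u == b] & v]|.
  by apply: eq_card => u; rewrite !inE ffunE; case: eqVneq.
by case: (x v) b => [] [].
Qed.

(** Every node other than [v] is a neighbour of [v], and [v] itself does not hold the opinion
    [~~ x v]. *)
Lemma flip_rateE x v :
  flip_rate alpha (@complete_graph n) x v = rate (count (~~ x v) x).
Proof.
have deg : degree (@complete_graph n) v = n.-1.
  rewrite -[in RHS](card_ord n) -(cardC1 v).
  by apply: eq_card => u; rewrite !inE eq_sym.
rewrite /flip_rate deg /rate.
suff -> : neighbours_with (@complete_graph n) x v (~~ x v) = count (~~ x v) x by [].
apply: eq_card => u; rewrite !inE /complete_graph /=.
by case: (eqVneq v u) => [<-|//]; case: (x v).
Qed.

Lemma generator_two_choices g x :
  generator (two_choices alpha (@complete_graph n)) g x =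
  \sum_v rate (count (~~ x v) x) * (g (flip x v) - g x).
Proof.
under [RHS]eq_bigr do rewrite -flip_rateE mulrBr.
rewrite sumrB -mulr_suml /generator (bigD1 x)//= addrC; congr (_ + _); last first.
  by rewrite /two_choices eqxx mulNr.
under eq_bigr => y yx.
  rewrite /two_choices (negbTE yx) mulr_suml; over.
rewrite (exchange_big_dep predT)//=; apply: eq_bigr => v _.
rewrite (bigD1 (flip x v))/= ?flip_neq ?eqxx// big1 ?addr0// => y.
by move=> /andP[/andP[_ /eqP ->]]; rewrite eqxx.
Qed.

(** Nodes not holding [b] give the births and the others the deaths. Both opinions follow the same
    birth-death chain; keeping [b] general lets each drift estimate be proved once. *)
Lemma generator_count b (f : nat -> R) x : let a := count b x in
  generator (two_choices alpha (@complete_graph n)) (fun y => f (count b y)) x =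
  (n - a)%:R * rate a * (f a.+1 - f a) +
  a%:R * rate (n - a) * (f a.-1 - f a).
Proof.
move=> a; have ca : count (~~ b) x = (n - a)%N by rewrite -(countC b x) addKn.
rewrite generator_two_choices (bigID [pred v | x v == b])/= addrC; congr (_ + _).
  rewrite (eq_bigr (fun=> rate a * (f a.+1 - f a))).
    rewrite sumr_const -[LHS]mulr_natl mulrA -ca /count.
    congr (_%:R * _ * _); apply: eq_card => v; rewrite !inE.
    by rewrite unfold_in; move: (x v) (b) => [] [].
  move=> v xvb; rewrite count_flip (negbTE xvb).
  by rewrite (_ : ~~ x v = b)//; move: xvb; move: (x v) (b) => [] [].
rewrite (eq_bigr (fun=> rate (n - a) * (f a.-1 - f a))).
  by rewrite sumr_const -[LHS]mulr_natl mulrA.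
by move=> v xvb; rewrite count_flip xvb (eqP xvb) ca.
Qed.

(** Flip the disagreements with [y] one at a time; the Hamming distance [D x] is at most [n]. *)
Lemma diameter_le (F : config 'I_n -> R) L x y : 0 <= L ->
  (forall x v, `|F x - F (flip x v)| <= L) -> `|F x - F y| <= n%:R * L.
Proof.
move=> L0 FL; pose D x := #|[pred v | x v != y v]|.
apply: (@le_trans _ _ ((D x)%:R * L)); last first.
  by rewrite ler_wpM2r// ler_nat -[leqRHS]card_ord max_card.
elim: {x}(D x) {-2}x (erefl (D x)) => [|k IH] x Dx.
  have -> : x = y; last by rewrite subrr normr0 mulr_ge0.
  apply/ffunP => v; apply/eqP; apply: contraT => xy.
  by move: Dx => /card0_eq/(_ v); rewrite !inE xy.
have /card_gt0P[v] : (0 < D x)%N by rewrite Dx.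
rewrite inE => xv.
have Dk : D (flip x v) = k.
  apply/eqP; rewrite -eqSS -Dx /D [in eqbRHS](cardD1 v) !inE xv eqSS; apply/eqP.
  apply: eq_card => u; rewrite !inE ffunE.
  by case: (eqVneq u v) => [->|//]; case: (x v) (y v) xv => [] [].
have := IH _ Dk; rewrite Dk => H; rewrite Dx -natr1 mulrDl mul1r [leRHS]addrC.
by rewrite -(subrKA (F (flip x v))) (le_trans (ler_normD _ _))// lerD.
Qed.

End CompleteGraph.

(** * Contraction of Lipschitz constants on the hypercube *)

Section FastMixing.
Context {R : realType}.
Variables (alpha : R) (n : nat).
Hypotheses (alpha0 : 0 < alpha) (alpha1 : alpha < 1) (n_ge2 : (2 <= n)%N).

Implicit Types (x y : config 'I_n) (u v : 'I_n) (b : bool).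

Let q := two_choices alpha (@complete_graph n).
Let N : R := n.-1%:R.

Let N_gt0 : 0 < N. Proof. by rewrite ltr0n -ltnS (ltn_predK n_ge2). Qed.
Let nE : n%:R = N + 1.
Proof. by rewrite natr1 (ltn_predK n_ge2). Qed.

Lemma rate_ge0 k : 0 <= rate alpha n k.
Proof.
rewrite addr_ge0 ?divr_ge0 ?(ltW alpha0)//.
by rewrite mulr_ge0 ?subr_ge0 ?(ltW alpha1)// sqr_ge0.
Qed.

Lemma rate_le1 k : (k <= n.-1)%N -> rate alpha n k <= 1.
Proof.
move=> kN; have : (k%:R / N) ^+ 2 <= 1.
  by rewrite exprn_ile1 ?divr_ge0// ?ler_pdivrMr ?mul1r ?ler_nat.
rewrite /rate -/N; set z := _ ^+ 2 => z1.
have : (1 - alpha) * z <= 1 - alpha by rewrite ler_piMr// subr_ge0 ltW.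
move: alpha0; lra.
Qed.

Lemma count_self x u : (0 < count (x u) x)%N.
Proof. by apply/card_gt0P; exists u; rewrite !inE. Qed.

Let r x v := rate alpha n (count (~~ x v) x).

(* The expression is the contraction rate of the coupling in which two
   configurations that differ at [u] only are updated together. *)
Lemma rate_contraction c x u :
  c <= (3 * alpha - 1) / 2 - (1 - alpha) / N ->
  c <= r x u + r (flip x u) u - \sum_(v | v != u) `|r x v - r (flip x u) v|.
Proof.
move=> hc; have [m mE] : exists m, count (~~ x u) x = m by exists (count (~~ x u) x).
have cb : count (x u) x = (n - m)%N by have := countC (x u) x; rewrite mE; lia.
have mN : (m <= n.-1)%N.
  by have := count_self x u; rewrite cb; lia.
have cyb : count (x u) (flip x u) = (n.-1 - m)%N.
  by rewrite count_flip eqxx cb; lia.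
have cynb : count (~~ x u) (flip x u) = m.+1.
  by rewrite count_flip mE; case: (x u).
have NmE : (n.-1 - m)%:R = N - m%:R :> R by rewrite natrB.
have nmE : (n - m)%:R = N - m%:R + 1 :> R.
  by rewrite natrB; [rewrite nE; ring|lia].
(* Flipping [u] changes the opposing count of a node [v] from [m] to [m + 1] if [v] agrees with [u]
   in [x] ([N - m] nodes), and from [N - m + 1] to [N - m] otherwise ([m] nodes). The summands are
   differences of consecutive squares. *)
have -> : \sum_(v | v != u) `|r x v - r (flip x u) v| =
    (1 - alpha) * ((N - m%:R) * (2 * m%:R + 1) +
                    m%:R * (2 * (N - m%:R) + 1)) / N ^+ 2.
  rewrite (bigID [pred v | x v == x u])/=.
  rewrite (eq_bigr (fun=> (1 - alpha) * (2 * m%:R + 1) / N ^+ 2)); last first.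
    move=> v /andP[vu /eqP xv].
    rewrite /r ffunE (negbTE vu) xv mE cynb /rate -/N distrC.
    rewrite (_ : _ - _ = (1 - alpha) * (2 * m%:R + 1) / N ^+ 2); last first.
      by rewrite -natr1; field; exact: lt0r_neq0.
    by rewrite ger0_norm// divr_ge0 ?sqr_ge0// mulr_ge0 ?subr_ge0 ?ltW// addr_ge0 ?mulr_ge0.
  rewrite [X in _ + X](eq_bigr (fun=>
      (1 - alpha) * (2 * (N - m%:R) + 1) / N ^+ 2)); last first.
    move=> v /andP[vu xv]; have xvu : ~~ x v = x u.
      by case: (x v) (x u) xv => [] [].
    rewrite /r ffunE (negbTE vu) xvu cb cyb /rate -/N nmE NmE.
    rewrite (_ : _ - _ = (1 - alpha) * (2 * (N - m%:R) + 1) / N ^+ 2); last first.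
      by field; exact: lt0r_neq0.
    rewrite ger0_norm// divr_ge0 ?sqr_ge0// mulr_ge0 ?subr_ge0 ?(ltW alpha1)//.
    by rewrite addr_ge0 ?mulr_ge0 ?subr_ge0 ?ler_nat.
  rewrite !sumr_const.
  have -> : #|[pred v | (v != u) && (x v == x u)]| = (n.-1 - m)%N.
    have := cb; rewrite /count (cardD1 u) !inE eqxx => /= H.
    rewrite -(_ : (n - m).-1 = n.-1 - m)%N ?subnS; last by lia.
    by rewrite -H; apply: eq_card => v; rewrite !inE.
  have -> : #|[pred v | (v != u) && (x v != x u)]| = m.
    rewrite -mE; apply: eq_card => v; rewrite !inE.
    by have [->|_] := eqVneq v u; case: (x u); case: (x v).
  rewrite -[X in X + _]mulr_natr -[X in _ + X]mulr_natr NmE; field.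
  exact: lt0r_neq0.
rewrite /r ffunE eqxx negbK cyb mE /rate -/N NmE.
(* The excess is a nonnegative multiple of a square that vanishes at [m = N / 2]: balanced
   surroundings are the worst case and produce the threshold 1/3. *)
rewrite (_ : _ - _ = (3 * alpha - 1) / 2 - (1 - alpha) / N +
   (1 - alpha) * (3 / 2 * ((2 * m%:R - N) / N) ^+ 2)); last first.
  by field; exact: lt0r_neq0.
apply: ler_wpDr => //; apply: mulr_ge0; first by rewrite subr_ge0 ltW.
by rewrite mulr_ge0 ?sqr_ge0.
Qed.

(** Couple [x] with [y = flip x u]. A flip of [u] in one of them merges the pair, a common flip of
    [v] keeps it adjacent, and the mismatch of the rates at [v] costs at most [L] per unit. The
    total rate is at most [n + 1], so [h <= n.+1%:R^-1] keeps the coefficient of [g x - g y]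
    nonnegative. *)
Lemma generator_contraction c (g : config 'I_n -> R) L h :
  c <= (3 * alpha - 1) / 2 - (1 - alpha) / N ->
  0 <= h <= n.+1%:R^-1 ->
  (forall x v, `|g x - g (flip x v)| <= L) ->
  forall x u, `|(g x + h * generator q g x) -
    (g (flip x u) + h * generator q g (flip x u))| <= (1 - c * h) * L.
Proof.
move=> hc /andP[h0 hn] gL x u; have L0 : 0 <= L := le_trans (normr_ge0 _) (gL x u).
set y := flip x u.
have := rate_contraction x u hc; rewrite -/y => cle.
have r_ge0 z v : 0 <= r z v by exact: rate_ge0.
have r_le1 z v : r z v <= 1.
  by apply: rate_le1; have := countC (z v) z; have := count_self z v; lia.
have genE z : generator q g z = \sum_v r z v * (g (flip z v) - g z).
  exact: generator_two_choices.
rewrite !genE.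
set D := g x - g y; pose T := \sum_(v | v != u) r x v.
have -> : (g x + h * \sum_v r x v * (g (flip x v) - g x)) -
    (g y + h * \sum_v r y v * (g (flip y v) - g y)) =
    D * (1 - h * (r x u + r y u + T)) +
    h * \sum_(v | v != u) (r x v * (g (flip x v) - g (flip y v)) +
                           (r x v - r y v) * (g (flip y v) - g y)).
  rewrite (bigD1 u)//= [X in _ - (_ + _ * X)](bigD1 u)//= -/y flipK /T.
  have -> : \sum_(v | v != u) (r x v * (g (flip x v) - g (flip y v)) +
              (r x v - r y v) * (g (flip y v) - g y)) =
      \sum_(v | v != u) r x v * (g (flip x v) - g x) -
      \sum_(v | v != u) r y v * (g (flip y v) - g y) +
      (\sum_(v | v != u) r x v) * D.
    rewrite mulr_suml -sumrB -big_split; apply: eq_bigr => v _ /=.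
    by rewrite /D; ring.
  by rewrite /D; ring.
have rest : r x u + r y u + T <= n.+1%:R.
  have : T <= n.-1%:R.
    rewrite -[X in _ <= X.-1%:R](card_ord n) -(cardC1 u) -sum1_card natr_sum.
    by apply: ler_sum => v _; exact: r_le1.
  rewrite -natr1 nE -/N; have := r_le1 x u; have := r_le1 y u; lra.
have coef0 : 0 <= 1 - h * (r x u + r y u + T).
  rewrite subr_ge0 (le_trans (ler_wpM2l h0 rest))//.
  by rewrite -ler_pdivlMr ?ltr0n// div1r.
apply: (le_trans (ler_normD _ _)); rewrite !normrM (ger0_norm coef0) (ger0_norm h0).
apply: (@le_trans _ _ (L * (1 - h * (r x u + r y u + T)) +
    h * (T * L + (\sum_(v | v != u) `|r x v - r y v|) * L))).
  apply: lerD; first by rewrite ler_wpM2r// gL.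
  rewrite ler_wpM2l// !mulr_suml -big_split (le_trans (ler_norm_sum _ _ _))//=.
  apply: ler_sum => v _; rewrite (le_trans (ler_normD _ _))// lerD// normrM.
    by rewrite (ger0_norm (r_ge0 x v)) ler_wpM2l// /y flipC gL.
  by rewrite ler_wpM2l// distrC gL.
rewrite -subr_ge0; set s := \sum_(v | v != u) `|_| in cle *.
rewrite (_ : _ - _ = h * L * (r x u + r y u - s - c)); last by ring.
by rewrite !mulr_ge0// subr_ge0.
Qed.

End FastMixing.

(** * Logarithmic upper bounds above the threshold *)

Section FastMixingBounds.
Context {R : realType}.
Variables (alpha : R) (n : nat).
Hypotheses (alpha0 : 0 < alpha) (alpha1 : alpha < 1) (n_ge2 : (2 <= n)%N).

Let q := two_choices alpha (@complete_graph n).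
Let N : R := n.-1%:R.

Context {d : measure_display} {Omega : measurableType d}.
Variables (X : R -> Omega -> config 'I_n) (P : config 'I_n -> probability Omega R)
  (pi : config 'I_n -> R).
Hypotheses (hX : markov_chain q X P) (hpi : stationary q pi).

(** At time [2 / c * ln n] the contraction factor is [n ^ -2]. The hypercube has diameter [n], so
    two starting points differ by at most [1 / n], and [4 <= n]. *)
Lemma mixing_time_upper c : (4 <= n)%N -> 0 < c ->
  c <= (3 * alpha - 1) / 2 - (1 - alpha) / N ->
  (mixing_time X P pi <= (2 / c * ln n%:R)%:E)%E.
Proof.
move=> n4 c0 hc; have n_gt0 : 0 < n%:R :> R by rewrite ltr0n; lia.
have lnn : 0 <= ln n%:R :> R by rewrite ln_ge0// ler1n; lia.
set t := 2 / c * _; have t0 : 0 <= t by rewrite mulr_ge0// divr_ge0// ltW.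
apply: mixing_time_le => //.
apply: (distance_to_stationarity_le hX hpi) => // D x y.
have -> : 4^-1 = (n%:R / 4) * (n%:R^-1) :> R.
  by field; rewrite gt_eqF.
pose F x := \sum_z transition q t x z * (D z)%:R.
have := @diameter_le R n F (expR (- (c * t))) x y (expR_ge0 _).
have -> : c * t = 2 * ln n%:R by rewrite /t; field; rewrite gt_eqF.
have expE : expR (- (2 * ln n%:R)) = (n%:R^-1) ^+ 2 :> R.
  by rewrite expRN mulr_natl mulr2n expRD lnK ?posrE// invfM expr2.
rewrite expE => /(_ _)/le_trans; apply; last first.
  rewrite expr2 mulrA ler_pM2r ?invr_gt0// mulfV ?gt_eqF//.
  by rewrite ler_pdivlMr// mul1r ler_nat.
move=> {}x v; rewrite -expE -[X in expR (- X)](_ : c * t = _); last first.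
  by rewrite /t; field; rewrite gt_eqF.
apply: (transition_contraction hX (e := [rel x y | [exists v, y == flip x v]])
  (h1 := n.+1%:R^-1)) => //=.
- exact: ltW.
- move=> g L h hh gL {}x {}y /existsP[u /eqP ->].
  apply: (generator_contraction alpha0 alpha1 n_ge2 hc hh) => z w.
  by apply: gL; apply/existsP; exists w.
- by apply/existsP; exists v.
Qed.

Let s : R := Num.sqrt n%:R.
Let f (K : R) (k : nat) : R := \sum_(0 <= j < k) K / (j.+1%:R + s).

Lemma generatorD (g1 g2 : config 'I_n -> R) x :
  generator q (fun y => g1 y + g2 y) x = generator q g1 x + generator q g2 x.
Proof.
by rewrite /generator -big_split; apply: eq_bigr => y _; rewrite mulrDr.
Qed.

Let s2 : s ^+ 2 = n%:R. Proof. by rewrite sqr_sqrtr. Qed.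
Let s_gt0 : 0 < s. Proof. by rewrite sqrtr_gt0 ltr0n; lia. Qed.

(** With [w = k1 + s], the generator equals [-K ((qm - qp) w + qm) / (w (w + 1))], where [qp] and
    [qm] are the birth and death rates. The drift gives [(qm - qp) w >= 2 c k1 ^ 2], the concavity
    of [f] leaves [qm >= n alpha / 4], and [n = s ^ 2]. The two summands of [K] normalise these two
    contributions. *)
Lemma drift_le (c K : R) b x (u := uphalf n) : 0 < c ->
  (1 - alpha) * (n%:R / (2 * N)) ^+ 2 + c <= alpha / 2 ->
  4 / c + 16 / alpha <= K ->
  (u < count b x)%N ->
  generator q (fun y => f K (count b y - u)%N) x <= -1.
Proof.
move=> c0 hc hK ux; rewrite (generator_count alpha b (fun a => f K (a - u)%N)).
set a := count b x in ux *; have an : (a <= n)%N.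
  by rewrite -[leqRHS](countC b x) leq_addr.
have [k ak] : exists k, a = (u + k.+1)%N by exists (a - u).-1; lia.
have -> : (a.+1 - u = k.+2)%N by lia.
have -> : (a - u = k.+1)%N by lia.
have -> : (a.-1 - u = k)%N by lia.
have fS j : f K j.+1 = f K j + K / (j.+1%:R + s).
  by rewrite /f big_nat_recr.
have -> : f K k.+2 - f K k.+1 = K / (k.+2%:R + s).
  by rewrite (fS k.+1) [LHS]addrC addKr.
have -> : f K k - f K k.+1 = - (K / (k.+1%:R + s)).
  by rewrite fS opprD addrA subrr add0r.
have N0 : 0 < N by rewrite ltr0n; lia.
set A : R := a%:R; set nn : R := n%:R; set k1 : R := k.+1%:R.
have -> : (n - a)%:R = nn - A by rewrite natrB.
have k1_ge1 : 1 <= k1 by rewrite ler1n.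
have -> : k.+2%:R = k1 + 1 :> R by rewrite natr1.
have A2 : nn + 2 * k1 <= 2 * A.
  rewrite /nn /k1 /A ak -!natrM -natrD ler_nat.
  by have := uphalf_half n; rewrite -/u; have := odd_double_half n; lia.
have Ann : A <= nn by rewrite ler_nat.
have A0 : 0 <= A by [].
pose rp := rate alpha n a; pose rm := rate alpha n (n - a).
rewrite -/rp -/rm.
have rm_ge : alpha / 2 <= rm.
  by rewrite lerDl mulr_ge0 ?sqr_ge0// subr_ge0 ltW.
have diff : c * (2 * k1) <= A * rm - (nn - A) * rp.
  have -> : A * rm - (nn - A) * rp = (2 * A - nn) *
      (alpha / 2 - (1 - alpha) * (A * (nn - A) / N ^+ 2)).
    rewrite /rm /rp /rate -/N natrB// -/A -/nn; field; exact: lt0r_neq0.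
  have AnA : A * (nn - A) / N ^+ 2 <= (nn / (2 * N)) ^+ 2.
    have -> : (nn / (2 * N)) ^+ 2 = (nn ^+ 2 / 4) / N ^+ 2.
      by field; exact: lt0r_neq0.
    rewrite ler_pM2r ?invr_gt0 ?exprn_gt0//.
    by rewrite -subr_ge0 (_ : _ - _ = ((2 * A - nn) / 2) ^+ 2) ?sqr_ge0//; field.
  have H : c <= alpha / 2 - (1 - alpha) * (A * (nn - A) / N ^+ 2).
    have := ler_wpM2l (_ : 0 <= 1 - alpha) AnA; rewrite subr_ge0 ltW// => /(_ isT).
    move: hc; rewrite -/nn; lra.
  rewrite mulrC; apply: ler_pM => //; [lra|exact: ltW|lra].
have s0 := s_gt0; set w := k1 + s; have w0 : 0 < w by rewrite /w; lra.
have -> : k1 + 1 + s = w + 1 by rewrite /w; ring.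
have w1 : 0 < w + 1 by lra.
have K0 : 0 < K by apply: lt_le_trans hK; rewrite addr_gt0// divr_gt0.
have -> : (nn - A) * rp * (K / (w + 1)) + A * rm * - (K / w) =
    - (K * ((A * rm - (nn - A) * rp) * w + A * rm) / (w * (w + 1))).
  by field; rewrite !gt_eqF.
rewrite lerN2 ler_pdivlMr ?mulr_gt0// mul1r.
have Arm : nn * alpha / 4 <= A * rm.
  apply: (@le_trans _ _ (A * (alpha / 2))); last by rewrite ler_wpM2l.
  have := ler_wpM2r (ltW alpha0) (_ : nn <= 2 * A); rewrite (_ : nn <= _); last lra.
  move=> /(_ isT); lra.
have diffw : c * (2 * k1) * k1 <= (A * rm - (nn - A) * rp) * w.
  apply: ler_pM => //; rewrite ?mulr_ge0 ?ltW//; rewrite /w; lra.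
apply: (@le_trans _ _ (K * (c * (2 * k1) * k1 + nn * alpha / 4))); last first.
  by rewrite ler_pM2l// lerD.
apply: (@le_trans _ _ ((4 / c + 16 / alpha) *
    (c * (2 * k1) * k1 + nn * alpha / 4))); last first.
  by apply: ler_wpM2r hK; rewrite addr_ge0 ?divr_ge0 ?mulr_ge0// ltW.
(* The cross terms are dropped. What is left dominates [2 * w ^+ 2], hence [w * (w + 1)] because
   [1 <= w]. *)
rewrite (_ : (4 / c + 16 / alpha) * _ = 8 * k1 ^+ 2 + 4 * nn +
    (nn * alpha / c + 32 * c * k1 ^+ 2 / alpha)); last first.
  by field; rewrite !gt_eqF.
apply: ler_wpDr.
  by rewrite addr_ge0// !mulr_ge0 ?invr_ge0 ?exprn_ge0// ltW.
rewrite /nn -s2 /w.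
have k1s : 0 <= (k1 - s) ^+ 2 by exact: sqr_ge0.
have : (k1 + s) * (k1 + s + 1) <= (k1 + s) * (2 * (k1 + s)).
  by rewrite ler_pM2l//; lra.
rewrite !expr2 in k1s *; have : 0 <= k1 * k1 by rewrite mulr_ge0.
lra.
Qed.

Lemma drift_eq0 K b x (u := uphalf n) : (count b x < u)%N ->
  generator q (fun y => f K (count b y - u)%N) x = 0.
Proof.
move=> xu; rewrite (generator_count alpha b (fun a => f K (a - u)%N)).
set a := count b x in xu *.
have -> : (a.+1 - u = 0)%N by apply/eqP; rewrite subn_eq0.
have -> : (a - u = 0)%N by apply/eqP; rewrite subn_eq0 ltnW.
have -> : (a.-1 - u = 0)%N.
  by apply/eqP; rewrite subn_eq0 (leq_trans (leq_pred a))// ltnW.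
by rewrite subrr !mulr0 addr0.
Qed.

(** The induction step [1 / (m + 2) <= ln ((m + 2) / (m + 1))] is [1 + x <= expR x] at
    [x = - 1 / (m + 2)]. *)
Lemma harmonic_sum_le m :
  \sum_(0 <= j < m.+1) (j.+1%:R : R)^-1 <= 1 + ln m.+1%:R.
Proof.
elim: m => [|m IH]; first by rewrite big_nat1 invr1 ln1 addr0.
rewrite big_nat_recr//= (le_trans (lerD IH (lexx _)))// -addrA lerD2l.
have m1 : 0 < m.+1%:R :> R by rewrite ltr0n.
have m2 : 0 < m.+2%:R :> R by rewrite ltr0n.
rewrite -lerBrDr -ler_expR lnK ?posrE// expRD lnK ?posrE//.
have := expR_ge1Dx (- m.+2%:R^-1 : R); rewrite -(ler_pM2l m2).
rewrite mulrDr mulr1 mulrN mulfV ?gt_eqF// -[X in X - 1]natr1 addrK.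
by [].
Qed.

Lemma integral_hitting_time_upper (c K : R) x : 0 < c ->
  (1 - alpha) * (n%:R / (2 * N)) ^+ 2 + c <= alpha / 2 ->
  4 / c + 16 / alpha <= K ->
  (\int[P x]_w hitting_time X (@balanced n) w <= (4 * K * (1 + ln n%:R))%:E)%E.
Proof.
move=> c0 hc hK; pose u := uphalf n.
have K0 : 0 < K by apply: lt_le_trans hK; rewrite addr_gt0// divr_gt0.
have term0 j : 0 <= K / (j.+1%:R + s).
  by rewrite divr_ge0 ?addr_ge0 ?(ltW K0) ?(ltW s_gt0).
have f0 k : 0 <= f K k by apply: sumr_ge0 => j _.
(* Off the balanced set exactly one opinion has count above [u]; the other count is strictly below
   [u], where its summand stays 0 even after one birth. The sum thus inherits the drift of the
   majority term. *)
pose psi (y : config 'I_n) :=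
  f K (count true y - u)%N + f K (count false y - u)%N.
apply: (@le_trans _ _ (2 * psi x)%:E); last first.
  have f_le k : (k <= n)%N -> f K k <= K * (1 + ln n%:R).
    move=> kn; apply: (@le_trans _ _ (K * \sum_(0 <= j < n) j.+1%:R^-1)).
      rewrite mulr_sumr (big_cat_nat _ (n := k))//= -[leLHS]addr0 lerD//.
        apply: ler_sum => j _; rewrite ler_pM2l// lef_pV2 ?posrE ?addr_gt0 ?ltr0n//.
        by rewrite lerDl ltW.
      by apply: sumr_ge0 => j _; rewrite mulr_ge0 ?(ltW K0)// invr_ge0.
    by rewrite ler_pM2l//; have := harmonic_sum_le n.-1; rewrite (ltn_predK n_ge2).
  have cn b : (count b x - u <= n)%N.
    by rewrite (leq_trans (leq_subr _ _))// -[leqRHS](countC b x) leq_addr.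
  rewrite lee_fin /psi; have := f_le _ (cn true); have := f_le _ (cn false); lra.
apply: (integral_hitting_time_le hX) => [y|y nB]; first exact: addr_ge0.
rewrite generatorD; move: nB; rewrite /balanced -count_true negb_or -/u.
move=> /andP[n1 n2]; have tf := countC true y; rewrite /= in tf.
have uh : (n./2 <= u <= n./2.+1)%N by rewrite /u; lia.
have un : (u + n./2 = n)%N by rewrite /u; lia.
have [ut|tu] := ltnP u (count true y).
  rewrite [X in _ + X]drift_eq0 ?addr0; first exact: drift_le hc hK ut.
  by lia.
have fu : (u < count false y)%N by lia.
by rewrite [X in X + _]drift_eq0 ?add0r; [exact: drift_le hc hK fu|lia].
Qed.

End FastMixingBounds.

(** * Exponential lower bounds below the threshold *)

Section SlowMixing.
Context {R : realType}.

Lemma prob_le_hitting_time {S : finType} {d : measure_display}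
    {Omega : measurableType d} (q : S -> S -> R) (X : R -> Omega -> S)
    (P : S -> probability Omega R) (B C : pred S) (t : R) (T : \bar R) x :
  markov_chain q X P -> (forall y, B y -> C y) -> 0 <= t -> (t%:E < T)%E ->
  (P x [set w | B (X t w)] <= P x [set w | (hitting_time X C w < T)%E])%E.
Proof.
move=> hX BC t0 tT; apply: le_measure; rewrite ?inE.
- exact: measurable_state hX _ _ _.
- exact: measurable_hitting_time_lt hX _ _.
- move=> w /= /BC Cw; exact: le_lt_trans (hitting_time_le t0 Cw) tT.
Qed.

Lemma hitting_time_mono {S : finType} {d : measure_display}
    {Omega : measurableType d} (X : R -> Omega -> S)
    (B C : pred S) w :
  (forall y, B y -> C y) -> (hitting_time X C w <= hitting_time X B w)%E.
Proof.
move=> BC; apply: ereal_inf_le_tmp => _ [t [t0 Bt] <-]; exists t => //.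
by split=> //; exact: BC.
Qed.

Section FixedSize.
Variables (alpha : R) (n : nat).
Hypotheses (alpha0 : 0 < alpha) (alpha1 : alpha < 1) (n_ge2 : (2 <= n)%N).

Let q := two_choices alpha (@complete_graph n).
Let N : R := n.-1%:R.

Context {d : measure_display} {Omega : measurableType d}.
Variables (X : R -> Omega -> config 'I_n) (P : config 'I_n -> probability Omega R).
Hypothesis hX : markov_chain q X P.

(** Between [L] and [H] the function [rho ^+ (a - L)] has nonpositive drift. Above [H], where
    failures may pull [a] back, its drift is only bounded by [n * rho ^+ (H - L)], which is small
    because the function itself is. *)
Lemma prob_hitting_time_le_expn (rho T : R) b (L H : nat) x :
  0 < rho -> rho < 1 -> (L <= H)%N ->
  (forall a, (L < a)%N -> (a <= H)%N ->
    a%:R * rate alpha n (n - a) <= rho * ((n - a)%:R * rate alpha n a)) ->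
  0 < T ->
  (P x [set w | (hitting_time X (fun y => count b y <= L)%N w < T%:E)%E] <=
    (rho ^+ (count b x - L) + n%:R * rho ^+ (H - L) * T)%:E)%E.
Proof.
move=> rho0 rho1 LH drift T0; have r0 k : 0 <= rate alpha n k by exact: rate_ge0.
apply: (prob_hitting_time_lt hX (phi := fun y => rho ^+ (count b y - L)%N)) => //.
- by move=> y; rewrite exprn_ge0 ?ltW.
- by move=> y yL; rewrite (eqP (_ : count b y - L == 0)%N)// subn_eq0.
- by rewrite mulr_ge0// exprn_ge0// ltW.
move=> y; rewrite -ltnNge => Ly.
rewrite (generator_count alpha b (fun a => rho ^+ (a - L)%N)).
set a := count b y in Ly *; have an : (a <= n)%N.
  by rewrite -[leqRHS](countC b y) leq_addr.
have [k ak] : exists k, a = (L + k.+1)%N by exists (a - L).-1; lia.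
have -> : (a.+1 - L = k.+2)%N by lia.
have -> : (a - L = k.+1)%N by lia.
have -> : (a.-1 - L = k)%N by lia.
rewrite !exprS; have rhok : 0 <= rho ^+ k by rewrite exprn_ge0// ltW.
set qp := _ * rate alpha n a; set qm := a%:R * _.
have qp0 : 0 <= qp by rewrite mulr_ge0.
have qm0 : 0 <= qm by rewrite mulr_ge0.
rewrite (_ : _ + _ = rho ^+ k * (1 - rho) * (qm - rho * qp)); last by ring.
have [aH|Ha] := leqP a H.
  apply: (@le_trans _ _ 0); last by rewrite mulr_ge0// exprn_ge0// ltW.
  rewrite mulr_ge0_le0//; first by rewrite mulr_ge0// subr_ge0 ltW.
  by rewrite subr_le0 drift.
have qmn : qm <= n%:R.
  rewrite -[leRHS]mulr1 ler_pM ?ler_nat//; apply: rate_le1 => //; lia.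
have : rho ^+ k <= rho ^+ (H - L) by apply: ler_wiXn2l; [exact: ltW|exact: ltW|lia].
move=> kH; rewrite [leRHS]mulrC -mulrA.
apply: (@le_trans _ _ (rho ^+ k * n%:R)); last by rewrite ler_wpM2r.
rewrite ler_wpM2l//.
apply: (@le_trans _ _ ((1 - rho) * qm)).
  by rewrite ler_wpM2l ?subr_ge0 ?(ltW rho1)// lerBlDr lerDl mulr_ge0// ltW.
by apply: le_trans qmn; rewrite ler_piMl// lerBlDr lerDl ltW.
Qed.

(** With [p = a / n], births exceed deaths by [n (2 p - 1) ((1 - alpha) p (1 - p) (n / N) ^ 2 -
    alpha / 2)], and [p (1 - p)] decreases beyond 1/2, so [p2] is its worst case. Births being at
    most [n] turns the difference into a ratio. *)
Lemma drift_ratio (eta p1 p2 : R) (a : nat) :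
  1 / 2 < p1 -> p2 < 1 -> 0 < eta -> eta <= (1 - alpha) * (p2 * (1 - p2)) - alpha / 2 ->
  n%:R * p1 <= a%:R -> a%:R <= n%:R * p2 ->
  a%:R * rate alpha n (n - a) <=
    (1 - (2 * p1 - 1) * eta) * ((n - a)%:R * rate alpha n a).
Proof.
move=> p1_gt p2_lt eta0 heta p1a ap2.
have n0 : 0 < n%:R :> R by rewrite ltr0n; lia.
have N0 : 0 < N by rewrite ltr0n; lia.
have an : (a < n)%N.
  by rewrite -(ltr_nat R) (le_lt_trans ap2)// gtr_pMr.
pose p : R := a%:R / n%:R; have aE : a%:R = p * n%:R by rewrite /p divfK// gt_eqF.
have p1p : p1 <= p by rewrite /p ler_pdivlMr// mulrC.
have pp2 : p <= p2 by rewrite /p ler_pdivrMr// mulrC.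
set qm := a%:R * _; set qp := (n - a)%:R * _.
have qpn : qp <= n%:R.
  rewrite -[leRHS]mulr1 ler_pM ?rate_ge0 ?ler_nat ?leq_subr//.
  by apply: rate_le1 => //; rewrite -ltnS (ltn_predK n_ge2).
have diff : qp - qm = n%:R * ((2 * p - 1) *
    ((1 - alpha) * (p * (1 - p)) * (n%:R / N) ^+ 2 - alpha / 2)).
  rewrite /qp /qm /rate natrB ?(ltnW an)// aE -/N.
  by field; exact: lt0r_neq0.
have nN : 1 <= (n%:R / N) ^+ 2.
  by rewrite exprn_ege1// ler_pdivlMr// mul1r ler_nat leq_pred.
have pp : p2 * (1 - p2) <= p * (1 - p).
  rewrite -subr_ge0 (_ : _ - _ = (p2 - p) * (p2 + p - 1)); last by ring.
  by rewrite mulr_ge0; lra.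
have etap : eta <= (1 - alpha) * (p * (1 - p)) * (n%:R / N) ^+ 2 - alpha / 2.
  have H1 := ler_wpM2l (_ : 0 <= 1 - alpha) pp.
  have {}H1 : (1 - alpha) * (p2 * (1 - p2)) <= (1 - alpha) * (p * (1 - p)).
    by apply: H1; rewrite subr_ge0 ltW.
  have : (1 - alpha) * (p * (1 - p)) <= (1 - alpha) * (p * (1 - p)) * (n%:R / N) ^+ 2.
    by rewrite ler_peMr// mulr_ge0 ?subr_ge0 ?ltW// mulr_gt0; lra.
  lra.
have : n%:R * ((2 * p1 - 1) * eta) <= qp - qm.
  rewrite diff ler_pM2l//; apply: ler_pM => //; lra.
have : (2 * p1 - 1) * eta * qp <= n%:R * ((2 * p1 - 1) * eta).
  by rewrite mulrC; apply: ler_wpM2r => //; rewrite mulr_ge0; lra.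
lra.
Qed.

End FixedSize.
Lemma uphalf_mul2_le n : (uphalf n * 2 <= n.+1)%N.
Proof. by lia. Qed.

Lemma slow_hitting (alpha p : R) : 0 < alpha -> alpha < 1 / 3 -> 1 / 2 < p ->
  exists (kappa K : R) (n0 : nat), 0 < kappa /\
    forall n, (n0 <= n)%N -> (2 <= n)%N ->
    forall (d : measure_display) (Omega : measurableType d)
      (X : R -> Omega -> config 'I_n) (P : config 'I_n -> probability Omega R),
    markov_chain (two_choices alpha (@complete_graph n)) X P ->
    forall b x, n%:R * p - 1 <= (count b x)%:R ->
    (P x [set w | (hitting_time X (fun y => count b y <= uphalf n)%N w
        < (expR (kappa * n%:R))%:E)%E] <= (K / n%:R)%:E)%E.
Proof.
move=> alpha0 alpha3 p2.
(* [beta] is [(1 - alpha) / 4 - alpha / 2], the drift factor at one half. [delta] keeps at least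
   half of it up to density [1 / 2 + delta], and puts that density below [p]. *)
pose beta : R := (1 - 3 * alpha) / 4; have beta0 : 0 < beta by rewrite /beta; lra.
pose delta : R := Order.min (beta / 2) ((p - 1 / 2) / 2).
have delta0 : 0 < delta by rewrite lt_min; apply/andP; split; lra.
have delta_beta : delta <= beta / 2 by rewrite ge_min lexx.
have delta_p : delta <= (p - 1 / 2) / 2 by rewrite ge_min lexx orbT.
have delta_le : delta <= 1 / 8 by move: delta_beta; rewrite /beta; lra.
pose c : R := delta * (beta / 2); have c0 : 0 < c.
  by apply: mulr_gt0 => //; exact: divr_gt0.
have c1 : c < 1.
  have : delta * (beta / 2) <= 1 / 8 * (beta / 2).
    by apply: ler_wpM2r delta_le; apply: divr_ge0 => //; exact: ltW.
  by rewrite -/c /beta; lra.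
(* The band between [L] and [H] has width about [n * delta / 2], so powers of [1 - c] across it are
   of order [expR (- (2 * kappa * n))]; multiplying by the time horizon [expR (kappa * n)] still
   leaves exponential decay. *)
pose kappa : R := c * delta / 4; have kappa0 : 0 < kappa.
  by apply: divr_gt0 => //; exact: mulr_gt0.
exists kappa, (4 * expR 1 / kappa ^+ 2), (Num.bound (1 / delta)); split => //.
move=> n n0n n2 d Omega X P hX b x hx.
have n_gt0 : 0 < n%:R :> R by rewrite ltr0n (leq_trans _ n2).
have n_ge1 : 1 <= n%:R :> R by rewrite ler1n (leq_trans _ n2).
(* Absorbs the rounding when [uphalf n] is compared with [L]. *)
have nd : 1 <= n%:R * delta.
  rewrite -ler_pdivrMr//; apply: ltW; apply: (lt_le_trans (archi_boundP _)).
    by rewrite divr_ge0// ltW.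
  by rewrite ler_nat.
pose p1 : R := 1 / 2 + delta / 2; pose p2' : R := 1 / 2 + delta.
have np1 : 0 <= n%:R * p1 by rewrite mulr_ge0// /p1; lra.
have np2 : 0 <= n%:R * p2' by rewrite mulr_ge0// /p2'; lra.
pose L := Num.truncn (n%:R * p1); pose H := Num.truncn (n%:R * p2').
have /andP[L1 L2] := truncn_itv np1; rewrite -/L -natr1 in L1 L2.
have /andP[H1 H2] := truncn_itv np2; rewrite -/H -natr1 in H1 H2.
have np12 : n%:R * p2' = n%:R * p1 + n%:R * delta / 2.
  by rewrite /p1 /p2'; field.
have LH : (L <= H)%N by rewrite -ltnS -(ltr_nat R) -natr1; lra.
have uL : (uphalf n <= L)%N.
  rewrite -ltnS -(ltr_nat R) -natr1; apply: le_lt_trans L2.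
  have : (uphalf n)%:R * 2 <= n%:R + 1 :> R.
    by rewrite -natrM natr1 ler_nat uphalf_mul2_le.
  have -> : n%:R * p1 = n%:R / 2 + n%:R * delta / 2 by rewrite /p1; field.
  lra.
have rho_exp k : n%:R * delta / 2 - 1 <= k%:R ->
    (1 - c) ^+ k <= expR 1 * expR (- (2 * kappa * n%:R)).
  move=> hk; apply: (@le_trans _ _ (expR (- c) ^+ k)).
    by apply: lerXn2r; rewrite ?nnegrE ?expR_ge0 ?subr_ge0 ?(ltW c1)//; exact: expR_ge1Dx.
  rewrite -expRM_natl -expRD ler_expR.
  have := ler_wpM2l (ltW c0) hk; rewrite /kappa; lra.
have drift a : (L < a)%N -> (a <= H)%N ->
    a%:R * rate alpha n (n - a) <= (1 - c) * ((n - a)%:R * rate alpha n a).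
  move=> La aH.
  have -> : c = (2 * p1 - 1) * (beta / 2) by rewrite /c /p1; field.
  apply: (drift_ratio alpha0 _ n2 (p2 := p2')) => //; rewrite ?/p1 ?/p2'; try lra.
  - have : delta * delta <= beta / 2.
      apply: le_trans delta_beta; rewrite ler_piMr//; lra.
    have -> : (1 / 2 + delta) * (1 - (1 / 2 + delta)) = 1 / 4 - delta * delta.
      by field.
    have : 0 <= alpha * (delta * delta) by rewrite !mulr_ge0// ltW.
    by rewrite /beta; lra.
  - by rewrite -/p1; apply: (le_trans (ltW L2)); rewrite natr1 ler_nat.
  - by rewrite -/p2'; apply: le_trans H1; rewrite ler_nat.
have alpha1 : alpha < 1 by lra.
have rho0 : 0 < 1 - c by rewrite subr_gt0.
have rho1 : 1 - c < 1 by rewrite ltrBlDr ltrDl.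
have T0 := expR_gt0 (kappa * n%:R).
have := prob_hitting_time_le_expn alpha0 alpha1 n2 hX b x rho0 rho1 LH drift T0.
move=> PL; apply: (le_trans (le_trans _ PL)).
  apply: le_measure; rewrite ?inE; [exact: measurable_hitting_time_lt hX _ _..|].
  move=> w /=; apply: le_lt_trans; apply: hitting_time_mono => y /leq_trans.
  exact.
rewrite lee_fin; set E := expR (kappa * n%:R) in T0 *.
have expE : expR (- (2 * kappa * n%:R)) = E^-1 * E^-1.
  by rewrite -!expRN -expRD; congr expR; ring.
have np_le : n%:R * p1 + n%:R * delta / 2 <= n%:R * p.
  by rewrite -np12 ler_pM2l// /p2'; lra.
have e1 := rho_exp (count b x - L)%N; have e2 := rho_exp (H - L)%N.
have {}e1 : (1 - c) ^+ (count b x - L) <= expR 1 * (E^-1 * E^-1).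
  rewrite -expE; apply: e1; apply: (@le_trans _ _ ((count b x)%:R - L%:R)); first lra.
  by rewrite lerBlDr -natrD ler_nat addnC -leq_subLR.
have {}e2 : (1 - c) ^+ (H - L) <= expR 1 * (E^-1 * E^-1).
  by rewrite -expE; apply: e2; rewrite natrB//; lra.
(* A quadratic lower bound on the exponential is enough: it turns [n / E] into a multiple of
   [1 / n]. *)
have Ege : (kappa * n%:R) ^+ 2 / 2 <= E.
  have := @expR_ge1Dxn R (kappa * n%:R) 1 (mulr_ge0 (ltW kappa0) (ltW n_gt0)).
  by rewrite (_ : 2`! = 2)%N//; apply: le_trans; rewrite lerDr.
have kn0 : 0 < (kappa * n%:R) ^+ 2 by apply: exprn_gt0; exact: mulr_gt0.
have Einv : E^-1 <= 2 / (kappa * n%:R) ^+ 2.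
  rewrite -(invf_div _ 2) lef_pV2 ?posrE//; exact: divr_gt0.
have E1 : 1 <= E by rewrite -[leLHS]expR0 ler_expR mulr_ge0// ltW.
have Einv1 : E^-1 <= 1 by rewrite invf_le1.
apply: (@le_trans _ _ (expR 1 * E^-1 * (1 + n%:R))).
  apply: (@le_trans _ _ (expR 1 * (E^-1 * E^-1) + n%:R * (expR 1 * (E^-1 * E^-1)) * E)).
    by rewrite lerD// ler_pM2r// ler_pM2l.
  rewrite (_ : _ + n%:R * _ * _ = expR 1 * E^-1 * (E^-1 + n%:R)); last first.
    by field; rewrite gt_eqF.
  by rewrite ler_wpM2l ?lerD2r// mulr_ge0 ?expR_ge0// invr_ge0 ltW.
apply: (@le_trans _ _ (expR 1 * (2 / (kappa * n%:R) ^+ 2) * (2 * n%:R))).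
  apply: ler_pM; rewrite ?mulr_ge0 ?expR_ge0 ?invr_ge0 ?(ltW T0) ?addr_ge0//; last lra.
  by rewrite ler_wpM2l ?expR_ge0.
rewrite le_eqVlt; apply/orP; left; apply/eqP; field.
by rewrite !gt_eqF.
Qed.

End SlowMixing.

(** * Assembly of the two regimes *)

Lemma count_cst (n : nat) b c :
  count b ([ffun=> c] : config 'I_n) = if c == b then n else 0%N.
Proof.
rewrite /count; case: ifPn => [/eqP ->|cb].
  by rewrite -[RHS](card_ord n); apply: eq_card => v; rewrite !inE ffunE eqxx.
by apply: eq_card0 => v; rewrite !inE ffunE (negbTE cb).
Qed.

Lemma balanced_count_le (n : nat) b (x : config 'I_n) :
  balanced x -> (count b x <= uphalf n)%N.
Proof.
have uh : (n./2 <= uphalf n)%N by lia.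
have un : (uphalf n + n./2 = n)%N by lia.
rewrite /balanced -count_true => /orP[]/eqP xE.
  by case: b; [rewrite xE|have := countC true x; rewrite /= xE; lia].
by case: b; [rewrite xE|have := countC true x; rewrite /= xE; lia].
Qed.

Lemma near_nat_ge {R : realType} (a : R) : \forall n \near \oo, a <= n%:R.
Proof.
near=> n; apply: (@le_trans _ _ (Num.bound `|a|)%:R).
  exact: le_trans (ler_norm a) (ltW (archi_boundP (normr_ge0 a))).
by rewrite ler_nat; near: n; exact: nbhs_infty_ge.
Unshelve. all: by end_near.
Qed.

Theorem theorem4p1 (R : realType) (alpha : R)
    (d : nat -> measure_display) (Omega : forall n, measurableType (d n))
    (X : forall n, R -> Omega n -> config 'I_n)
    (P : forall n, config 'I_n -> probability (Omega n) R)
    (pi : forall n, config 'I_n -> R)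
    (halpha0 : 0 < alpha) (halpha1 : alpha < 1)
    (hX : forall n, (2 <= n)%N ->
      markov_chain (two_choices alpha (@complete_graph n)) (@X n) (@P n))
    (hpi : forall n, (2 <= n)%N ->
      stationary (two_choices alpha (@complete_graph n)) (@pi n)) :
  (alpha < 1 / 3 ->
    (exists kappa : R, 0 < kappa /\
      \forall n \near \oo,
        ((expR (kappa * n%:R))%:E <= mixing_time (@X n) (@P n) (@pi n))%E) /\
    (forall p : R, 0 <= p -> p <= 1 -> p != 1 / 2 ->
      exists kappa : R, 0 < kappa /\
        forall x : forall n, config 'I_n,
          (forall n, (ones (x n))%:Z = Num.ceil (n%:R * p)) ->
          (fun n => @P n (x n) [set w | ((expR (kappa * n%:R))%:E <=
              hitting_time (@X n) (@balanced n) w)%E]) @ \oo --> 1%:E)) /\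
  (1 / 3 < alpha ->
    (exists C : R, \forall n \near \oo,
      (mixing_time (@X n) (@P n) (@pi n) <= (C * ln n%:R)%:E)%E) /\
    (exists C : R, \forall n \near \oo,
      forall (a : nat) (x : config 'I_n), (a <= n)%N -> ones x = a ->
        (\int[@P n x]_w hitting_time (@X n) (@balanced n) w
           <= (C * ln n%:R)%:E)%E)).
Proof.
split=> [alpha3|alpha3]; split.
(* Density 1 is consensus on [b]. From there the configurations with at most [uphalf n] nodes of
   opinion [b] are rarely reached, and for the two values of [b] these sets cover the space. *)
- have [|kappa [K [n0 [kappa0 H]]]] := @slow_hitting R alpha 1 halpha0 alpha3.
    by lra.
  exists kappa; split => //; near=> n.
  have n0n : (n0 <= n)%N by near: n; exact: nbhs_infty_ge.
  have n2 : (2 <= n)%N by near: n; exact: nbhs_infty_ge.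
  have Kn : 10 * K <= n%:R by near: n; exact: near_nat_ge.
  have {}H b (t : R) : 0 <= t < expR (kappa * n%:R) ->
      (@P n [ffun=> b] [set w | (count b (@X n t w) <= uphalf n)%N] <=
       (10^-1)%:E)%E.
    move=> /andP[t0 tT].
    pose B (y : config 'I_n) := (count b y <= uphalf n)%N.
    have tT' : (t%:E < (expR (kappa * n%:R))%:E)%E by rewrite lte_fin.
    apply: (le_trans (prob_le_hitting_time [ffun=> b] (hX n n2)
      (fun y (yB : B y) => yB) t0 tT')).
    apply: (le_trans (H n n0n n2 _ _ _ _ (hX n n2) b [ffun=> b] _)).
      by rewrite count_cst eqxx mulr1 lerBlDr lerDl.
    rewrite lee_fin ler_pdivrMr ?ltr0n ?(leq_trans _ n2)//; lra.
  apply: (mixing_time_ge (hX n n2) (hpi n n2)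
    (D := fun z => (count true z <= uphalf n)%N)
    (E := fun z => (count false z <= uphalf n)%N)
    (x := [ffun=> true]) (y := [ffun=> false])) => [z|t tT]; last first.
    by split; exact: H.
  by have := countC true z; have := uphalf_half n; have := odd_double_half n; rewrite /=; lia.
- move=> p p0 p1 p_half.
  (* [b] is the initial majority opinion. The loss of 1 is due to the ceiling: if [p < 1 / 2], the
     zeros number more than [n * (1 - p) - 1]. *)
  have [b [p' [p'_gt hb]]] : exists b (p' : R), 1 / 2 < p' /\
      forall n (x : config 'I_n), (ones x)%:Z = Num.ceil (n%:R * p) ->
      n%:R * p' - 1 <= (count b x)%:R.
    have ceilE n (x : config 'I_n) : (ones x)%:Z = Num.ceil (n%:R * p) ->
        n%:R * p <= (ones x)%:R < n%:R * p + 1.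
      move=> xE; have -> : (ones x)%:R = ((ones x)%:Z)%:~R :> R by [].
      have := ceil_itv (n%:R * p); rewrite -xE rmorphB /= -[1%:~R]/1.
      move=> /andP[lt1 ->]; lra.
    have [p_lt|p_gt] := ltP p (1 / 2).
      exists false, (1 - p); split; first lra.
      move=> n x /ceilE/andP[_ xlt].
      have := countC true x; rewrite count_true /= => /(congr1 (fun k => k%:R : R)).
      rewrite natrD; lra.
    exists true, p; split; first by rewrite lt_neqAle eq_sym p_half.
    by move=> n x /ceilE/andP[xge _]; rewrite count_true; lra.
  have [kappa [K [n0 [kappa0 H]]]] := slow_hitting halpha0 alpha3 p'_gt.
  exists kappa; split => // x xE.
  have cvg1 : (1 - K / n%:R)%:E @[n --> \oo] --> 1%:E.
    apply: cvg_EFin; first by near=> n.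
    rewrite -[X in _ --> X](subr0 1); apply: cvgB; first exact: cvg_cst.
    rewrite -cvg_shiftS; have : K * n.+1%:R^-1 @[n --> \oo] --> K * 0.
      by apply: cvgM; [exact: cvg_cst|exact: cvg_harmonic].
    by rewrite mulr0.
  apply: (squeeze_cvge (h := fun=> 1%E) _ cvg1); last exact: cvg_cst.
  near=> n.
  have n0n : (n0 <= n)%N by near: n; exact: nbhs_infty_ge.
  have n2 : (2 <= n)%N by near: n; exact: nbhs_infty_ge.
  set T := (expR (kappa * n%:R))%:E.
  have mlt B := measurable_hitting_time_lt (hX n n2) B T.
  have -> : [set w | (T <= hitting_time (@X n) (@balanced n) w)%E] =
      ~` [set w | (hitting_time (@X n) (@balanced n) w < T)%E].
    by apply/seteqP; split => w /=; rewrite leNgt => /negP.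
  rewrite probability_le1 ?andbT; last exact: measurableC.
  rewrite probability_setC// EFinB leeB//.
  apply: le_trans (H n n0n n2 _ _ _ _ (hX n n2) b (x n) (hb _ _ (xE n))).
  apply: le_measure; rewrite ?inE; [exact: mlt..|].
  move=> w /=; apply: le_lt_trans; apply: hitting_time_mono => y.
  exact: balanced_count_le.
(* Half of the limiting contraction rate [(3 * alpha - 1) / 2]; the other half absorbs
   [(1 - alpha) / n.-1]. *)
- pose c : R := (3 * alpha - 1) / 4; have c0 : 0 < c by rewrite /c; lra.
  exists (2 / c); near=> n.
  have n4 : (4 <= n)%N by near: n; exact: nbhs_infty_ge.
  have n2 : (2 <= n)%N by rewrite (leq_trans _ n4).
  apply: (mixing_time_upper halpha0 halpha1 n2 (hX n n2) (hpi n n2) n4 c0).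
  have N0 : 0 < n.-1%:R :> R by rewrite ltr0n -ltnS (ltn_predK n2).
  have cn : (1 - alpha) / c + 1 <= n%:R by near: n; exact: near_nat_ge.
  have : (1 - alpha) / n.-1%:R <= c.
    rewrite ler_pdivrMr// mulrC -ler_pdivrMr//.
    by rewrite -lerBrDr -(ltn_predK n2) -natr1 addrK in cn *.
  rewrite /c; lra.
(* Half of [alpha / 2 - (1 - alpha) / 4], the limiting restoring drift factor at one half; the other
   half absorbs the corrections of order [1 / n.-1]. *)
- pose c : R := (3 * alpha - 1) / 8; have c0 : 0 < c by rewrite /c; lra.
  pose K : R := 4 / c + 16 / alpha.
  have K0 : 0 < K by rewrite addr_gt0// divr_gt0.
  have ln2 : 0 < ln 2 :> R by rewrite ln_gt0// ltr1n.
  (* For [2 <= n] the additive 1 in [1 + ln n] is at most [ln n / ln 2]. *)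
  exists (4 * K * (1 + (ln 2)^-1)); near=> n => a x _ _.
  have n2 : (2 <= n)%N by near: n; exact: nbhs_infty_ge.
  have N0 : 0 < n.-1%:R :> R by rewrite ltr0n -ltnS (ltn_predK n2).
  have nE : n%:R = n.-1%:R + 1 :> R by rewrite natr1 (ltn_predK n2).
  have cn : c^-1 + 1 <= n%:R by near: n; exact: near_nat_ge.
  apply: (le_trans (integral_hitting_time_upper halpha0 halpha1 n2 (hX n n2) x c0
    (K := K) _ (lexx _))).
    set eps : R := n.-1%:R^-1; have eps0 : 0 < eps by rewrite invr_gt0.
    have eps_c : eps <= c.
      by rewrite /eps -[c]invrK lef_pV2 ?posrE ?invr_gt0//; lra.
    have eps1 : eps <= 1 by apply: le_trans eps_c _; rewrite /c; lra.
    have -> : (n%:R / (2 * n.-1%:R)) ^+ 2 = (1 + 2 * eps + eps * eps) / 4 :> R.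
      by rewrite nE /eps; field; rewrite gt_eqF.
    have e2 : eps * eps <= eps by rewrite ler_piMr// ltW.
    have : (1 - alpha) * ((1 + 2 * eps + eps * eps) / 4) <=
           (1 - alpha) * ((1 + 3 * eps) / 4).
      by rewrite ler_wpM2l ?subr_ge0 ?(ltW halpha1)//; lra.
    have : 0 <= alpha * eps by rewrite mulr_ge0 ?ltW.
    rewrite /c in eps_c *; lra.
  rewrite lee_fin -[leRHS]mulrA ler_wpM2l ?mulr_ge0 ?(ltW K0)//.
  rewrite mulrDl mul1r addrC lerD2l mulrC ler_pdivlMr// mul1r.
  by rewrite ler_ln ?posrE ?ltr0n ?(leq_trans _ n2)// ler_nat.
Unshelve. all: by end_near.
Qed.
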